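(* Let $\mathcal{A}=\mathcal{A}_n^{\bar q,\Lambda}(\mathbb{K})$ with no $q_k$ a root of unity. Every $\mathbb{K}$-algebra automorphism $h$ of $\mathcal{A}[t]=\mathcal{A}\otimes_{\mathbb{K}}\mathbb{K}[t]$ is triangular: there are $g\in\mathrm{Aut}_{\mathbb{K}}(\mathcal{A})$, $c\in\mathbb{K}^*$ and $r\in\mathbb{K}$ with $h|_{\mathcal{A}}=g$ and $h(t)=ct+r$; conversely every such data defines an automorphism. Thus $\mathrm{Aut}_{\mathbb{K}}(\mathcal{A}[t])=\begin{pmatrix}\mathrm{Aut}_{\mathbb{K}}(\mathcal{A}) & \mathbb{K}\\ 0 & \mathbb{K}^*\end{pmatrix}$. Moreover, if $\mathbb{K}$ has characteristic $0$, then the only locally nilpotent $\mathbb{K}$-derivation of $\mathcal{A}$ is $0$.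
   Context: Let $\mathbb{K}$ be a field, $n\ge 1$, $\bar q=(q_1,\dots,q_n)\in(\mathbb{K}^* )^n$, and $\Lambda=(\lambda_{ij})$ an $n\times n$ matrix over $\mathbb{K}^*$ with $\lambda_{ij}=\lambda_{ji}^{-1}$, $\lambda_{ii}=1$. $\mathcal{A}_n^{\bar q,\Lambda}(\mathbb{K})$ is the $\mathbb{K}$-algebra generated by $x_1,y_1,\dots,x_n,y_n$ with relations: for $1\le i<j\le n$, $x_ix_j=\lambda_{ij}x_jx_i$, $y_jy_i=\lambda_{ji}y_iy_j$, $x_iy_j=\lambda_{ji}y_jx_i$, $x_jy_i=\lambda_{ij}y_ix_j$; and $x_iy_i-q_iy_ix_i=1$ for all $i$. The matrix notation denotes the group of pairs $(g, (c,r))$ acting by $a\mapsto g(a)$ for $a\in\mathcal{A}$ and $t\mapsto ct+r$. A derivation $\partial$ is locally nilpotent if for each $a$ some power $\partial^k(a)=0$. *)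

(* Defs.v *)
From HB Require Import structures.
From mathcomp Require Import all_boot all_order all_algebra.
Set Implicit Arguments. Unset Strict Implicit. Unset Printing Implicit Defensive.
Import GRing.Theory.
Local Open Scope ring_scope.

Definition qweyl_rels (K : fieldType) (n : nat) (q : 'I_n -> K)
  (L : 'I_n -> 'I_n -> K) (B : algType K) (xB yB : 'I_n -> B) : Prop :=
  (forall i j : 'I_n, (i < j)%N ->
     [/\ xB i * xB j = L i j *: (xB j * xB i),
         yB j * yB i = L j i *: (yB i * yB j),
         xB i * yB j = L j i *: (yB j * xB i) &
         xB j * yB i = L i j *: (yB i * xB j)]) /\
  (forall i : 'I_n, xB i * yB i - q i *: (yB i * xB i) = 1).

Definition kalg_hom (K : fieldType) (A B : algType K) (f : A -> B) : Prop :=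
  [/\ forall a b, f (a + b) = f a + f b,
      forall a b, f (a * b) = f a * f b,
      f 1 = 1 &
      forall (k : K) a, f (k *: a) = k *: f a].

Definition kalg_aut (K : fieldType) (A : algType K) (f : A -> A) : Prop :=
  kalg_hom f /\ bijective f.

(* A is (a model of) A_n^{q,Lambda}(K): generated by x, y subject to the
   relations, expressed by the universal property of the presentation. *)
Definition is_qweyl (K : fieldType) (n : nat) (q : 'I_n -> K)
  (L : 'I_n -> 'I_n -> K) (A : algType K) (x y : 'I_n -> A) : Prop :=
  qweyl_rels q L x y /\
  forall (B : algType K) (xB yB : 'I_n -> B), qweyl_rels q L xB yB ->
    exists f : A -> B,
      [/\ kalg_hom f, (forall i, f (x i) = xB i), (forall i, f (y i) = yB i) &
          forall f' : A -> B, kalg_hom f' -> (forall i, f' (x i) = xB i) ->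
            (forall i, f' (y i) = yB i) -> forall a, f' a = f a].

(* A[t] = A (x)_K K[t] is modelled as {poly A} (t = 'X, central).
   K acts on {poly A} by left multiplication with the constant (k%:A)%:P. *)
Definition kalg_aut_poly (K : fieldType) (A : algType K)
  (h : {poly A} -> {poly A}) : Prop :=
  [/\ forall p p', h (p + p') = h p + h p',
      forall p p', h (p * p') = h p * h p',
      h 1 = 1,
      forall (k : K) p, h ((k%:A)%:P * p) = (k%:A)%:P * h p &
      bijective h].

Definition kderivation (K : fieldType) (A : algType K) (d : A -> A) : Prop :=
  [/\ forall a b, d (a + b) = d a + d b,
      forall (k : K) a, d (k *: a) = k *: d a &
      forall a b, d (a * b) = d a * b + a * d b].

Definition locally_nilpotent (T : zmodType) (d : T -> T) : Prop :=
  forall a, exists m : nat, iter m d a = 0.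

(* Main.v *)
Require Import Defs.
From HB Require Import structures.
From mathcomp Require Import all_boot all_order all_algebra ring.
From mathcomp Require boolp.
From mathcomp.multinomials Require Import ssrcomplements mpoly.
Set Implicit Arguments. Unset Strict Implicit. Unset Printing Implicit Defensive.
Import Order.TTheory GRing.Theory.
Local Open Scope ring_scope.

(** The regular representation on the PBW basis shows that A is a domain with
multiplicative leading monomials.  If f a = s(a) f for all generators a, comparing
leading coefficients shows that s determines the leading monomial of f, because no
q_i is a root of unity; so two elements with the same twist s are proportional.
With s = id this says that the center of A is K, hence an automorphism h of A[t]
maps the center K[t] to itself and h(t) = c t + r.  The element
z_i = x_i y_i - y_i x_i = 1 + (q_i - 1) y_i x_i is normal, so all the t-coefficients
of h(z_i) have the same twist and h(z_i) = P(t) w with w in A; applying the inverse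
of h, P is constant.  Then h(y_i) h(x_i) has degree 0 in t, and so have both
factors.  In characteristic 0 a locally nilpotent derivation d yields the
automorphism exp(t d) of A[t], which must preserve A, so d = 0. *)

(** A is known only through its universal property, so that x and y generate it is not given.
    Existence of factorizations yields a map into a concrete algebra, the endomorphisms of a
    polynomial space; uniqueness, tested on endomorphisms of A * A, yields that a linear map
    commuting with left multiplication by the generators commutes with left multiplication by all of
    A. Together they give the PBW expansion of every element. The scalars of Lambda are arbitrary
    and could mask the powers of q_i in a twist. But x_i and y_i have opposite weights, so Lambda
    drops out of the product of their two twists; what remains is a power of q_i, and this is where
    the root of unity hypothesis starts to bite. The detour through z_i is needed because x_i and
    y_i need not be normal, so their images under h cannot be compared with a twist directly. *)

Section LinearEndomorphisms.
Variables (K : fieldType) (V : lmodType K) (v0 : V).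

(* The phantom [v0 != 0] makes the ring nontrivial, as [algType] demands. *)
Record endo (nz : v0 != 0) : Type :=
  Endo { endo_fun :> V -> V; endo_linear : linear endo_fun }.

Variable nz : v0 != 0.
Implicit Types f g : endo nz.

Lemma endoP f g : f =1 g -> f = g.
Proof.
case: f g => [f fl] [g gl] /= /boolp.funext fg.
by move: fl gl; rewrite fg => fl gl; rewrite (boolp.Prop_irrelevance fl gl).
Qed.

(** Equality of functions is not decidable in general, so the structures below the ring hierarchy
    are supplied classically. *)
HB.instance Definition _ := boolp.gen_eqMixin (endo nz).
HB.instance Definition _ := boolp.gen_choiceMixin (endo nz).

Definition endo_mk (f : V -> V) (fl : linear f) : endo nz := Endo nz fl.

Lemma endo_zero_linear : linear (fun _ : V => 0 : V).
Proof. by move=> k u v; rewrite scaler0 addr0. Qed.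
Lemma endo_one_linear : linear (fun v : V => v).
Proof. by []. Qed.
Lemma endo_add_linear f g : linear (fun v => f v + g v).
Proof. by move=> k u v; rewrite !endo_linear scalerDr addrACA. Qed.
Lemma endo_scale_linear (c : K) f : linear (fun v => c *: f v).
Proof. by move=> k u v; rewrite endo_linear scalerDr !scalerA mulrC. Qed.
Lemma endo_mul_linear f g : linear (fun v => f (g v)).
Proof. by move=> k u v; rewrite !endo_linear. Qed.

Definition endo_scale c f := endo_mk (endo_scale_linear c f).

Fact endo_addA : associative (fun f g => endo_mk (endo_add_linear f g)).
Proof. by move=> f g h; apply: endoP => v /=; rewrite addrA. Qed.
Fact endo_addC : commutative (fun f g => endo_mk (endo_add_linear f g)).
Proof. by move=> f g; apply: endoP => v /=; rewrite addrC. Qed.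
Fact endo_add0 :
  left_id (endo_mk endo_zero_linear) (fun f g => endo_mk (endo_add_linear f g)).
Proof. by move=> f; apply: endoP => v /=; rewrite add0r. Qed.
Fact endo_addN : left_inverse (endo_mk endo_zero_linear) (endo_scale (-1))
  (fun f g => endo_mk (endo_add_linear f g)).
Proof. by move=> f; apply: endoP => v /=; rewrite scaleN1r addNr. Qed.
HB.instance Definition _ :=
  GRing.isZmodule.Build (endo nz) endo_addA endo_addC endo_add0 endo_addN.

Fact endo_mulA : associative (fun f g => endo_mk (endo_mul_linear f g)).
Proof. by move=> f g h; apply: endoP. Qed.
Fact endo_mul1 :
  left_id (endo_mk endo_one_linear) (fun f g => endo_mk (endo_mul_linear f g)).
Proof. by move=> f; apply: endoP. Qed.
Fact endo_mulr1 :
  right_id (endo_mk endo_one_linear) (fun f g => endo_mk (endo_mul_linear f g)).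
Proof. by move=> f; apply: endoP. Qed.
Fact endo_mulDl :
  left_distributive (fun f g => endo_mk (endo_mul_linear f g)) +%R.
Proof. by move=> f g h; apply: endoP. Qed.
Fact endo_mulDr :
  right_distributive (fun f g => endo_mk (endo_mul_linear f g)) +%R.
Proof.
move=> f g h; apply: endoP => v /=.
by have := endo_linear f 1 (g v) (h v); rewrite !scale1r.
Qed.
Fact endo_one_neq0 : endo_mk endo_one_linear != 0.
Proof.
apply/eqP => /(congr1 (fun f : endo nz => f v0)) /= e.
by move: nz; rewrite e eqxx.
Qed.
HB.instance Definition _ := GRing.Zmodule_isNzRing.Build (endo nz)
  endo_mulA endo_mul1 endo_mulr1 endo_mulDl endo_mulDr endo_one_neq0.

Fact endo_scaleA a b f :
  endo_scale a (endo_scale b f) = endo_scale (a * b) f.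
Proof. by apply: endoP => v /=; rewrite scalerA. Qed.
Fact endo_scale1 : left_id 1 endo_scale.
Proof. by move=> f; apply: endoP => v /=; rewrite scale1r. Qed.
Fact endo_scaleDr : right_distributive endo_scale +%R.
Proof. by move=> c f g; apply: endoP => v /=; rewrite scalerDr. Qed.
Fact endo_scaleDl f : {morph endo_scale^~ f : a b / a + b}.
Proof. by move=> a b; apply: endoP => v /=; rewrite scalerDl. Qed.
HB.instance Definition _ := GRing.Zmodule_isLmodule.Build K (endo nz)
  endo_scaleA endo_scale1 endo_scaleDr endo_scaleDl.

Fact endo_scaleAl (c : K) (f g : endo nz) : c *: (f * g) = (c *: f) * g.
Proof. by apply: endoP. Qed.
HB.instance Definition _ :=
  GRing.Lmodule_isLalgebra.Build K (endo nz) endo_scaleAl.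

Fact endo_scaleAr (c : K) (f g : endo nz) : c *: (f * g) = f * (c *: g).
Proof.
(* Linearity at [c - 1] with both vectors equal gives homogeneity without a detour through
   [f 0 = 0]. *)
apply: endoP => v /=; have := endo_linear f (c - 1) (g v) (g v).
by rewrite !scalerBl !scale1r !subrK => ->.
Qed.
HB.instance Definition _ :=
  GRing.Lalgebra_isAlgebra.Build K (endo nz) endo_scaleAr.

Lemma endo_addE f g v : (f + g) v = f v + g v. Proof. by []. Qed.
Lemma endo_mulE f g v : (f * g) v = f (g v). Proof. by []. Qed.
Lemma endo_scaleE (c : K) f v : (c *: f) v = c *: f v. Proof. by []. Qed.
Lemma endo_oneE v : (1 : endo nz) v = v. Proof. by []. Qed.
Lemma endo_subE f g v : (f - g) v = f v - g v.
Proof. by rewrite -scaleN1r endo_addE endo_scaleE scaleN1r. Qed.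

Lemma endoZ f (c : K) v : f (c *: v) = c *: f v.
Proof. by have := congr1 (fun g : endo nz => g v) (endo_scaleAr c f 1). Qed.
Lemma endoD f u v : f (u + v) = f u + f v.
Proof. by have := endo_linear f 1 u v; rewrite !scale1r. Qed.

End LinearEndomorphisms.

(** * Linear extension from monomials *)

Section LinearExtension.
Variables (K : fieldType) (N : nat) (V : lmodType K).
Implicit Types (T : 'X_{1..N} -> V) (p : {mpoly K[N]}).

Definition lext T p : V := \sum_(m <- msupp p) p@_m *: T m.

(** Supports vary with the polynomial; a bounded index set serves several polynomials at once, which
    additivity requires. *)
Lemma lextE k T p : (msize p <= k)%N ->
  lext T p = \sum_(m : 'X_{1..N < k}) p@_m *: T m.
Proof.
move=> pk; rewrite /lext; pose I : subFinType _ := 'X_{1..N < k}.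
rewrite (big_mksub I) //=; first last.
- by move=> m /msize_mdeg_lt/leq_trans; apply.
- exact: msupp_uniq.
rewrite big_rmcond //= => m; rewrite mcoeff_msupp negbK => /eqP ->.
by rewrite scale0r.
Qed.

Lemma lext_linear T : linear (lext T).
Proof.
move=> c p p'; pose k := maxn (msize p) (maxn (msize p') (msize (c *: p + p'))).
rewrite !(@lextE k) ?leq_max ?leqnn ?orbT //.
rewrite scaler_sumr -big_split /=; apply: eq_bigr => m _.
by rewrite mcoeffD mcoeffZ scalerDl scalerA.
Qed.

Lemma lextX T m : lext T 'X_[m] = T m.
Proof. by rewrite /lext msuppX big_seq1 mcoeffX eqxx scale1r. Qed.

Lemma linear_ext_mpoly (f g : {mpoly K[N]} -> V) : linear f -> linear g ->
  (forall m, f 'X_[m] = g 'X_[m]) -> f =1 g.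
Proof.
move=> fl gl fg p.
have f0 : f 0 = 0 by have := fl (-1) 0 0; rewrite scaler0 addr0 scaleN1r addNr.
have g0 : g 0 = 0 by have := gl (-1) 0 0; rewrite scaler0 addr0 scaleN1r addNr.
rewrite [p]mpolyE; elim: (msupp p) => [|m s IH]; first by rewrite big_nil f0.
by rewrite big_cons fl gl fg IH.
Qed.

End LinearExtension.

(* The regular representation of the quantized Weyl algebra on its PBW basis
   y_1^{a_1} x_1^{b_1} y_2^{a_2} x_2^{b_2} ..., which is encoded by the
   monomials of {mpoly K[n + n]}: variable [vy i] counts y_i, [vx i] counts x_i. *)
Section RegularRepresentation.
Variables (K : fieldType) (n : nat) (q : 'I_n -> K) (L : 'I_n -> 'I_n -> K).
Hypothesis L_neq0 : forall i j, L i j != 0.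
Hypothesis L_inv : forall i j, L i j = (L j i)^-1.

Definition vy (i : 'I_n) : 'I_(n + n) := lshift n i.
Definition vx (i : 'I_n) : 'I_(n + n) := rshift n i.

Lemma vy_eq i j : (vy i == vy j) = (i == j). Proof. exact: eq_lshift. Qed.
Lemma vx_eq i j : (vx i == vx j) = (i == j). Proof. exact: eq_rshift. Qed.
Lemma vy_vx i j : (vy i == vx j) = false. Proof. exact: eq_lrshift. Qed.
Lemma vx_vy i j : (vx i == vy j) = false. Proof. exact: eq_rlshift. Qed.

Lemma mnm_vP (m m' : 'X_{1..n + n}) :
  (forall i, m (vy i) = m' (vy i)) -> (forall i, m (vx i) = m' (vx i)) -> m = m'.
Proof.
move=> my mx; apply/mnmP => a; case: (split_ordP a) => i ->; [exact: my|exact: mx].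
Qed.

(** The Gaussian integer [k]_c, which appears when x_i passes y_i^k. *)
Definition qint (c : K) (k : nat) : K := \sum_(l < k) c ^+ l.

Lemma qint0 c : qint c 0 = 0. Proof. exact: big_ord0. Qed.
Lemma qintS c k : qint c k.+1 = qint c k + c ^+ k.
Proof. exact: big_ord_recr. Qed.
Lemma qintSl c k : qint c k.+1 = 1 + c * qint c k.
Proof.
rewrite /qint big_ord_recl expr0 mulr_sumr; congr (_ + _).
by apply: eq_bigr => l _; rewrite -exprS.
Qed.

(* Left multiplication by y_i is [My]; left multiplication by x_i either adds an
   x_i ([Mx]) or cancels a y_i ([Md]). *)
Inductive move := My | Mx | Md.
Implicit Types (s : move) (i j : 'I_n) (m : 'X_{1..n + n}).

Definition mv s i (m : 'X_{1..n + n}) : 'X_{1..n + n} :=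
  match s with
  | My => (m + U_(vy i))%MM | Mx => (m + U_(vx i))%MM | Md => (m - U_(vy i))%MM
  end.

(** Read off from x y^k = q^k y^k x + [k]_q y^(k-1). When no y_i is left, the truncated subtraction
    in [Md] does nothing, but [0]_q = 0 kills the term. *)
Definition cf s i (m : 'X_{1..n + n}) : K :=
  match s with
  | My => 1 | Mx => q i ^+ m (vy i) | Md => qint (q i) (m (vy i))
  end.

(** x_i has the weight opposite to y_i, so both moves caused by x_i meet the inverse scalar. *)
Definition sgn s (c : K) : K := if s is My then c else c^-1.

(* The scalar met when y_i is moved to the right of the blocks j < i. *)
Definition chi (i : 'I_n) (m : 'X_{1..n + n}) : K :=
  \prod_(j < n | (j < i)%N) (L i j ^+ m (vy j) * L j i ^+ m (vx j)).

Lemma chi_neq0 i m : chi i m != 0.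
Proof. by apply/prodf_neq0 => j _; rewrite mulf_neq0 // expf_neq0. Qed.

Lemma chi0 i : chi i 0%MM = 1.
Proof. by rewrite /chi big1 // => j _; rewrite !mnm0E !expr0 mulr1. Qed.

Lemma sgnM s c c' : sgn s (c * c') = sgn s c * sgn s c'.
Proof. by case: s => //=; rewrite invfM. Qed.

Lemma mv_vy s i j m : i != j -> mv s i m (vy j) = m (vy j).
Proof.
move=> /negPf ij; case: s; rewrite /= ?mnmDE ?mnmBE !mnm1E ?vy_eq ?vx_vy ?ij.
- by rewrite addn0.
- by rewrite addn0.
by rewrite subn0.
Qed.

Lemma mv_vx s i j m : i != j -> mv s i m (vx j) = m (vx j).
Proof.
move=> /negPf ij; case: s; rewrite /= ?mnmDE ?mnmBE !mnm1E ?vx_eq ?vy_vx ?ij;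
by rewrite ?addn0 ?subn0.
Qed.

Lemma cf_mv s i s' j m : i != j -> cf s i (mv s' j m) = cf s i m.
Proof. by move=> ij; case: s => //=; rewrite mv_vy // eq_sym. Qed.

Lemma chi_mv_ge s i j m : (i <= j)%N -> chi i (mv s j m) = chi i m.
Proof.
move=> ij; apply: eq_bigr => k ki.
have jk : j != k by apply: contraTneq (leq_trans ki ij) => ->; rewrite ltnn.
by rewrite mv_vy ?mv_vx.
Qed.

(** The condition on [cf] rules out [Md] at exponent 0, where truncation leaves [m] unchanged and
    the formula may fail. *)
Lemma chi_mv_lt s i j m : (i < j)%N -> cf s i m != 0 ->
  chi j (mv s i m) = chi j m * (if s is My then L j i else L i j).
Proof.
move=> ij; rewrite /chi (bigD1 i) //= [in RHS](bigD1 i) //= => cf0.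
rewrite [RHS]mulrAC; congr (_ * _); last first.
  by apply: eq_bigr => k /andP[_ ki]; rewrite mv_vy ?mv_vx // eq_sym.
case: s cf0 => /= cf0; rewrite ?mnmDE ?mnmBE !mnm1E ?vy_eq ?vx_eq ?vy_vx ?vx_vy
  ?eqxx ?addn0 ?subn0 ?addn1 ?exprSr.
- by rewrite mulrAC.
- by rewrite mulrA.
case: (m (vy i)) cf0 => [|k _]; first by rewrite qint0 eqxx.
rewrite subn1 exprSr -!mulrA; congr (_ * _).
by rewrite mulrCA [L j i]L_inv mulVf ?mulr1.
Qed.

Lemma mv_comm s i s' j m : i != j -> mv s i (mv s' j m) = mv s' j (mv s i m).
Proof.
move=> ij; apply: mnm_vP => k.
- have [<-|ik] := eqVneq i k.
    rewrite [RHS]mv_vy 1?eq_sym //; case: s => /=;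
    by rewrite ?mnmDE ?mnmBE mv_vy // eq_sym.
  rewrite mv_vy //; have [<-|jk] := eqVneq j k; last by rewrite !mv_vy.
  by case: s' => /=; rewrite ?mnmDE ?mnmBE mv_vy.
- have [<-|ik] := eqVneq i k.
    rewrite [RHS]mv_vx 1?eq_sym //; case: s => /=;
    by rewrite ?mnmDE ?mnmBE mv_vx // eq_sym.
  rewrite mv_vx //; have [<-|jk] := eqVneq j k; last by rewrite !mv_vx.
  by case: s' => /=; rewrite ?mnmDE ?mnmBE mv_vx.
Qed.

Local Notation V := {mpoly K[n + n]}.
Definition mpoly1_neq0 : (1 : V) != 0 := oner_neq0 _.
Local Notation EV := (endo mpoly1_neq0).

Definition step_fun s i : V -> V :=
  lext (fun m => (sgn s (chi i m) * cf s i m) *: 'X_[mv s i m]).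
Definition step s i : EV := Endo mpoly1_neq0 (lext_linear _ : linear (step_fun s i)).

Lemma stepX s i m : step s i 'X_[m] = (sgn s (chi i m) * cf s i m) *: 'X_[mv s i m].
Proof. exact: lextX. Qed.

Lemma endo_mpolyP (f g : EV) : (forall m, f 'X_[m] = g 'X_[m]) -> f = g.
Proof.
by move=> fg; apply/endoP/linear_ext_mpoly => //; apply: endo_linear.
Qed.

(** Only the later block sees the earlier one: a move at j leaves [chi i] alone, while a move at i
    multiplies [chi j] by one entry of L, which becomes the commutation scalar. If [cf s i m] is 0,
    both sides vanish. *)
Lemma step_comm s i s' j : (i < j)%N ->
  step s' j * step s i =
  sgn s' (if s is My then L j i else L i j) *: (step s i * step s' j).
Proof.
move=> ij; have nij : i != j by apply: contraTneq ij => ->; rewrite ltnn.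
apply: endo_mpolyP => m; rewrite endo_scaleE !endo_mulE !stepX !endoZ !stepX.
rewrite !scalerA (mv_comm s s' m nij); congr (_ *: _).
rewrite (cf_mv s') 1?eq_sym // (cf_mv s) // (chi_mv_ge s' m (ltnW ij)).
have [->|cf0] := eqVneq (cf s i m) 0; first by rewrite !(mulr0, mul0r).
by rewrite chi_mv_lt // sgnM; ring.
Qed.

Definition yop := step My.
Definition xop i := step Mx i + step Md i.

Lemma yopX i m : yop i 'X_[m] = chi i m *: 'X_[m + U_(vy i)].
Proof. by rewrite stepX /= mulr1. Qed.

Lemma xopX i m : xop i 'X_[m] = (chi i m)^-1 *:
  (q i ^+ m (vy i) *: 'X_[m + U_(vx i)] +
   qint (q i) (m (vy i)) *: 'X_[m - U_(vy i)]).
Proof. by rewrite endo_addE !stepX /= scalerDr !scalerA. Qed.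

Lemma regular_rels : qweyl_rels q L xop yop.
Proof.
split=> [i j ij|i].
  have C s s' := step_comm s s' ij.
  have C' s s' : step s i * step s' j =
     sgn s' (if s is My then L i j else L j i) *: (step s' j * step s i).
    rewrite C scalerA -sgnM; case: s; rewrite [L i j]L_inv ?mulVf ?mulfV //;
    by case: s'; rewrite /= ?invr1 scale1r.
  split.
  - by rewrite /xop !mulrDl !mulrDr !C' /= -L_inv !scalerDr addrACA.
  - exact: C.
  - by rewrite /xop mulrDl mulrDr !C' /= scalerDr.
  - by rewrite /xop mulrDl mulrDr !C /= -L_inv scalerDr.
have ci s m : chi i (mv s i m) = chi i m by rewrite chi_mv_ge.
apply: endo_mpolyP => m; rewrite endo_subE endo_scaleE !endo_mulE yopX xopX.
rewrite !endoZ xopX endoD !endoZ !yopX !(ci My) (ci Mx) (ci Md).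
move: (chi_neq0 i m); set c := chi i m => c0.
rewrite [c *: (c^-1 *: _)]scalerA mulfV // scale1r !scalerDr !scalerA.
rewrite !mnmDE !mnm1E eqxx addn1 addmK -!addmA [(U_(vx i) + _)%MM]addmC.
set k := m (vy i).
have -> : q i / c * q i ^+ k * c = q i ^+ k.+1 by rewrite exprS; field.
have -> : q i / c * qint (q i) k * c = q i * qint (q i) k by field.
rewrite opprD addrACA subrr add0r endo_oneE qintSl.
(* For k = 0 subtracting and adding back [U_(vy i)] does not restore [m], but the coefficient [0] is
   zero; for k > 0 it does, and [k+1] - q [k] = 1 concludes. *)
have [k0|k_gt0] := posnP k.
  by rewrite k0 qint0 mulr0 addr0 scale1r scale0r subr0.
rewrite submK; first by rewrite -scalerBl addrK scale1r.
apply/mnm_lepP => a; rewrite mnm1E.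
by have [<-|] := eqVneq (vy i) a.
Qed.

End RegularRepresentation.

(** * PBW monomials in A and coordinates with respect to them *)

Section QuantizedWeyl.
Variables (K : fieldType) (n : nat) (q : 'I_n -> K) (L : 'I_n -> 'I_n -> K).
Variables (A : algType K) (x y : 'I_n -> A).
Hypothesis L_neq0 : forall i j, L i j != 0.
Hypothesis L_inv : forall i j, L i j = (L j i)^-1.
Hypothesis L_diag : forall i, L i i = 1.
Hypothesis rels : qweyl_rels q L x y.
Implicit Types (i j : 'I_n) (m : 'X_{1..n + n}).

Lemma rel_xx i j : x i * x j = L i j *: (x j * x i).
Proof.
case: rels => R _; have [ij|ij|/val_inj <-] := ltngtP i j.
- by have [] := R _ _ ij.
- by have [-> _ _ _] := R _ _ ij; rewrite scalerA [L i j]L_inv mulVf // scale1r.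
- by rewrite L_diag scale1r.
Qed.

Lemma rel_yy i j : y i * y j = L i j *: (y j * y i).
Proof.
case: rels => R _; have [ij|ij|/val_inj <-] := ltngtP i j.
- have [_ -> _ _] := R _ _ ij; rewrite scalerA [L i j]L_inv mulVf // scale1r //.
- by have [_ -> _ _] := R _ _ ij.
- by rewrite L_diag scale1r.
Qed.

Lemma rel_xy i j : i != j -> x i * y j = L j i *: (y j * x i).
Proof.
case: rels => R _; have [ij|ij|/val_inj ->] := ltngtP i j; last by rewrite eqxx.
- by have [_ _ -> _] := R _ _ ij.
- by have [_ _ _ ->] := R _ _ ij.
Qed.

Lemma rel_yx i j : i != j -> y i * x j = L j i *: (x j * y i).
Proof.
by move=> ij; rewrite rel_xy 1?eq_sym // scalerA [L j i]L_inv mulVf // scale1r.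
Qed.

Lemma rel_xyi i : x i * y i = q i *: (y i * x i) + 1.
Proof. by case: rels => _ R; rewrite -(R i) addrC subrK. Qed.

Lemma xyX i k :
  x i * y i ^+ k = q i ^+ k *: (y i ^+ k * x i) + qint (q i) k *: y i ^+ k.-1.
Proof.
elim: k => [|k IH]; first by rewrite qint0 !expr0 scale0r addr0 scale1r mulr1 mul1r.
rewrite [in LHS]exprSr mulrA IH mulrDl -!scalerAl -[y i ^+ k * x i * _]mulrA.
rewrite rel_xyi mulrDr mulr1.
rewrite -scalerAr mulrA -exprSr scalerDr scalerA -exprSr -addrA; congr (_ + _).
rewrite qintS scalerDl addrC; congr (_ + _).
by case: k {IH} => [|k]; rewrite ?qint0 ?scale0r //= -exprSr.
Qed.

Lemma qcommX (c : K) (g u : A) k :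
  g * u = c *: (u * g) -> g * u ^+ k = c ^+ k *: (u ^+ k * g).
Proof.
move=> gu; elim: k => [|k IH]; first by rewrite !expr0 scale1r mulr1 mul1r.
rewrite [in LHS]exprS mulrA gu -scalerAl -[u * g * _]mulrA IH -scalerAr scalerA.
by rewrite -exprS mulrA -exprS.
Qed.

Lemma qcommM (c d : K) (g u v : A) : g * u = c *: (u * g) -> g * v = d *: (v * g) ->
  g * (u * v) = (c * d) *: (u * v * g).
Proof.
by move=> gu gv; rewrite mulrA gu -scalerAl -[u * g * v]mulrA gv -scalerAr scalerA mulrA.
Qed.

Lemma qcomm_prod (c : 'I_n -> K) (g : A) (u : 'I_n -> A) (s : seq 'I_n) :
  (forall j, j \in s -> g * u j = c j *: (u j * g)) ->
  g * \prod_(j <- s) u j = \prod_(j <- s) c j *: (\prod_(j <- s) u j * g).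
Proof.
elim: s => [|j s IH] gu; first by rewrite !big_nil scale1r mulr1 mul1r.
rewrite !big_cons; apply: qcommM; first by apply: gu; rewrite mem_head.
by apply: IH => k ks; apply: gu; rewrite in_cons ks orbT.
Qed.

(** In a noncommutative product the factor i has to be isolated in place. The prefix [s1] lists the
    indices below i, so the scalar collected in crossing it is exactly [chi]. *)
Lemma ord_prod_split i : exists s1 s2 : seq 'I_n,
  [/\ forall F : 'I_n -> A,
        \prod_(j < n) F j = \prod_(j <- s1) F j * F i * \prod_(j <- s2) F j,
      forall F : 'I_n -> K, \prod_(j < n | (j < i)%N) F j = \prod_(j <- s1) F j,
      i \notin s1 & i \notin s2].
Proof.
have es : pairwise (fun j k : 'I_n => (j < k)%N) (enum 'I_n).
  rewrite -(pairwise_map val ltn) val_enum_ord.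
  by rewrite -(sorted_pairwise ltn_trans) iota_ltn_sorted.
have : i \in enum 'I_n by rewrite mem_enum.
case/splitPr E : {1}(enum 'I_n) / => [s1 s2].
move: es; rewrite E pairwise_cat pairwise_cons /= => /and3P[].
rewrite allrel_consr => /andP[/allP lt1 _] _ /andP[/allP lt2 _].
exists s1, s2; split=> [F|F||].
- have -> : \prod_(j < n) F j = \prod_(j <- enum 'I_n) F j.
    by rewrite /index_enum unlock enumT.
  by rewrite E big_cat /= big_cons mulrA.
- have -> : \prod_(j < n | (j < i)%N) F j = \prod_(j <- enum 'I_n | (j < i)%N) F j.
    by rewrite big_enum_cond; apply: eq_bigl.
  rewrite E big_cat /= big_cons ltnn.
  rewrite [X in _ * X]big1_seq ?mulr1; last first.
    by move=> j /andP[ji /lt2 ij]; have := ltn_trans ij ji; rewrite ltnn.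
  by rewrite big_seq_cond [RHS]big_seq_cond; apply: eq_bigl => j;
    case: (boolP (j \in s1)) => // /lt1 ->.
- by apply/negP => /lt1; rewrite ltnn.
- by apply/negP => /lt2; rewrite ltnn.
Qed.

Definition block j m : A := y j ^+ m (vy j) * x j ^+ m (vx j).
Definition pbw m : A := \prod_(j < n) block j m.

Lemma pbw0 : pbw 0%MM = 1.
Proof. by rewrite /pbw big1 // => j _; rewrite /block !mnm0E !expr0 mulr1. Qed.

Lemma block_mv s i j m : i != j -> block j (mv s i m) = block j m.
Proof. by move=> ij; rewrite /block mv_vy ?mv_vx. Qed.

Lemma pbw_slot s i m (s1 s2 : seq 'I_n) : i \notin s1 -> i \notin s2 ->
    (forall F : 'I_n -> A,
      \prod_(j < n) F j = \prod_(j <- s1) F j * F i * \prod_(j <- s2) F j) ->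
  pbw (mv s i m) = \prod_(j <- s1) block j m * block i (mv s i m)
                   * \prod_(j <- s2) block j m.
Proof.
move=> i1 i2 splitE; rewrite /pbw splitE.
by congr (_ * _ * _); rewrite !big_seq; apply: eq_bigr => j js;
   rewrite block_mv //; [apply: contraNneq i1 | apply: contraNneq i2] => ->.
Qed.

(** The generator crosses the blocks before i and is absorbed by its own block. The outcome matches
    [yopX], so A mirrors the regular representation. *)
Lemma mul_y_pbw i m : y i * pbw m = chi L i m *: pbw (mv My i m).
Proof.
have [s1 [s2 [split_prod chiE i1 i2]]] := ord_prod_split i.
rewrite (pbw_slot My m i1 i2 split_prod) /chi chiE {1}/pbw split_prod.
have /qcomm_prod comm1 j : j \in s1 ->
    y i * block j m = (L i j ^+ m (vy j) * L j i ^+ m (vx j)) *: (block j m * y i).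
  move=> js; have ij : i != j by apply: contraNneq i1 => ->.
  by apply: qcommM; apply: qcommX; [exact: rel_yy|exact: rel_yx].
have -> : block i (mv My i m) = y i * block i m.
  rewrite /block /= !mnmDE !mnm1E vy_eq vy_vx eqxx addn1 addn0.
  by rewrite mulrA -exprS.
move: comm1; set p1 := \prod_(j <- s1) block j m; move: (block i m) => u comm1.
by rewrite !mulrA comm1 -!scalerAl.
Qed.

Lemma mul_x_pbw i m : x i * pbw m = (chi L i m)^-1 *:
  (q i ^+ m (vy i) *: pbw (mv Mx i m) + qint (q i) (m (vy i)) *: pbw (mv Md i m)).
Proof.
have [s1 [s2 [split_prod chiE i1 i2]]] := ord_prod_split i.
rewrite !(pbw_slot _ m i1 i2 split_prod) /chi chiE {1}/pbw split_prod.
have /qcomm_prod comm1 j : j \in s1 ->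
    x i * block j m =
    (L i j ^+ m (vy j) * L j i ^+ m (vx j))^-1 *: (block j m * x i).
  move=> js; have ij : i != j by apply: contraNneq i1 => ->.
  rewrite invfM -!exprVn -!L_inv.
  by apply: qcommM; apply: qcommX; [exact: rel_xy|exact: rel_xx].
have : x i * block i m = q i ^+ m (vy i) *: block i (mv Mx i m)
                          + qint (q i) (m (vy i)) *: block i (mv Md i m).
  rewrite /block /= !mnmDE !mnmBE !mnm1E vy_eq vx_eq vy_vx vx_vy eqxx.
  rewrite addn1 addn0 subn1 subn0 mulrA xyX mulrDl -!scalerAl.
  by rewrite -mulrA -exprS.
move: comm1; set p1 := \prod_(j <- s1) block j m.
move: (block i m) (block i (mv Mx i m)) (block i (mv Md i m)) => u u1 u2 comm1 xu.
rewrite !mulrA comm1 -!scalerAl prodfV -[p1 * x i * u]mulrA xu.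
by rewrite mulrDr mulrDl -!scalerAr -!scalerAl.
Qed.

Definition theta : {mpoly K[n + n]} -> A := lext pbw.

Lemma theta_linear : linear theta. Proof. exact: lext_linear. Qed.
HB.instance Definition _ := GRing.isLinear.Build K _ _ _ theta theta_linear.

Lemma thetaX m : theta 'X_[m] = pbw m. Proof. exact: lextX. Qed.

Lemma theta1 : theta 1 = 1. Proof. by rewrite -mpolyX0 thetaX pbw0. Qed.

Lemma theta_yop i v : theta (yop q L i v) = y i * theta v.
Proof.
move: v; apply: linear_ext_mpoly => [c u v|c u v|m].
- by rewrite endo_linear linearP.
- by rewrite linearP mulrDr scalerAr.
by rewrite yopX linearZ /= !thetaX mul_y_pbw.
Qed.

Lemma theta_xop i v : theta (xop q L i v) = x i * theta v.
Proof.
move: v; apply: linear_ext_mpoly => [c u v|c u v|m].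
- by rewrite endo_linear linearP.
- by rewrite linearP mulrDr scalerAr.
by rewrite xopX linearZ linearD !linearZ /= !thetaX mul_x_pbw.
Qed.

Hypothesis weyl : is_qweyl q L x y.

(* Conjugating the diagonal action on A * A by the shear (u, v) |-> (u + phi v, v)
   does not change the generators, so by uniqueness it changes nothing. *)
Lemma generator_linear (phi : {linear A -> A}) :
  (forall i a, phi (x i * a) = x i * phi a) ->
  (forall i a, phi (y i * a) = y i * phi a) ->
  forall a b, phi (a * b) = a * phi b.
Proof.
move=> phix phiy.
have nz : (1, 0) != 0 :> (A * A)%type.
  by apply/eqP => -[] /eqP; rewrite oner_eq0.
pose d a v := phi (a * v) - a * phi v.
have dP a c u v : d a (c *: u + v) = c *: d a u + d a v.
  by rewrite /d mulrDr -scalerAr !linearP /= mulrDr -scalerAr scalerBr opprD addrACA.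
have dD a b v : d (a + b) v = d a v + d b v.
  by rewrite /d !mulrDl linearD /= opprD addrACA.
have dM a b v : d (a * b) v = a * d b v + d a (b * v).
  by rewrite /d mulrBr !mulrA [RHS]addrC addrA subrK.
have dZ c a v : d (c *: a) v = c *: d a v.
  by rewrite /d -!scalerAl linearZ /= scalerBr.
have d1 v : d 1 v = 0 by rewrite /d !mul1r subrr.
pose sheared (a : A) (p : (A * A)%type) := (a * p.1 + d a p.2, a * p.2).
pose straight (a : A) (p : (A * A)%type) := (a * p.1, a * p.2).
have shl a : linear (sheared a).
  move=> c [u v] [u' v']; congr (_, _) => /=.
    by rewrite dP mulrDr -scalerAr addrACA -scalerDr.
  by rewrite mulrDr scalerAr.
have stl a : linear (straight a).
  by move=> c [u v] [u' v']; congr (_, _); rewrite /= mulrDr scalerAr.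
pose S a : endo nz := Endo nz (shl a).
pose T a : endo nz := Endo nz (stl a).
have homS : kalg_hom S.
  split=> [a b|a b||c a]; apply: endoP => -[u v]; congr (_, _) => /=.
  - by rewrite mulrDl dD addrACA.
  - by rewrite mulrDl.
  - by rewrite mulrDr dM mulrA addrA.
  - by rewrite mulrA.
  - by rewrite mul1r d1 addr0.
  - by rewrite mul1r.
  - by rewrite -scalerAl dZ -scalerDr.
  - by rewrite scalerAl.
have homT : kalg_hom T.
  split=> [a b|a b||c a]; apply: endoP => -[u v]; congr (_, _) => /=;
  by rewrite ?mulrDl ?mulrA ?mul1r ?scalerAl.
have relT : qweyl_rels q L (fun i => T (x i)) (fun i => T (y i)).
  case: homT rels => TD TM T1 TZ [R1 R2]; split=> [i j /R1[]|i].
    by rewrite -!TM -!TZ => -> -> -> ->.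
  rewrite -!TM -!TZ -T1 -[RHS](congr1 T (R2 i)) TD; congr (_ + _).
  by rewrite -[in RHS]scaleN1r [RHS]TZ scaleN1r.
have ST g : (forall a, phi (g * a) = g * phi a) -> S g = T g.
  by move=> pg; apply: endoP => -[u v]; rewrite /= /sheared /= /d pg subrr addr0.
have [f [_ _ _ f_uniq]] := weyl.2 _ _ _ relT.
move=> a b; have Sa : S a = f a.
  by apply: f_uniq => // i; apply: ST.
have Ta : T a = f a by apply: f_uniq.
(* At (0, b) the first components are the defect [d a b] and 0. *)
have /(congr1 fst) := congr1 (fun g : endo nz => g (0, b)) (etrans Sa (esym Ta)).
by rewrite /= !mulr0 add0r => /eqP; rewrite subr_eq0 => /eqP.
Qed.

(** [ev a] is the action of a on the vector 1. The composite of [ev] and [theta] commutes with left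
    multiplication by the generators and fixes 1, so [generator_linear] forces it to be the
    identity: the monomials [pbw m] span A. *)
Lemma pbw_coordinates : exists ev : A -> {mpoly K[n + n]},
  [/\ linear ev, ev 1 = 1, forall i a, ev (x i * a) = xop q L i (ev a),
      forall i a, ev (y i * a) = yop q L i (ev a) & cancel ev theta].
Proof.
have [f [[fD fM f1 fZ] fx fy _]] := weyl.2 _ _ _ (regular_rels q L_neq0 L_inv).
pose ev a : {mpoly K[n + n]} := f a 1.
have evl : linear ev by move=> c a b; rewrite /ev fD fZ.
have evx i a : ev (x i * a) = xop q L i (ev a) by rewrite /ev fM fx.
have evy i a : ev (y i * a) = yop q L i (ev a) by rewrite /ev fM fy.
have ev1 : ev 1 = 1 by rewrite /ev f1.
exists ev; split=> // a.
pose phi b := theta (ev b).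
have phil : linear phi by move=> c u v; rewrite /phi evl linearP.
pose phiL : {linear A -> A} :=
  HB.pack phi (GRing.isLinear.Build K _ _ _ phi phil).
have phix i b : phiL (x i * b) = x i * phiL b by rewrite /= /phi evx theta_xop.
have phiy i b : phiL (y i * b) = y i * phiL b by rewrite /= /phi evy theta_yop.
have := generator_linear phix phiy a 1.
by rewrite mulr1 /= /phi ev1 theta1 mulr1.
Qed.

End QuantizedWeyl.

(** * Leading terms in the monomial order *)

Section LeadingTerms.
Variables (K : fieldType) (N : nat).
Implicit Types (u v : {mpoly K[N]}) (m : 'X_{1..N}).

(** The coefficient c may be 0, so that the predicate is stable under sums even when leading terms
    cancel. *)
Definition leadat v m (c : K) :=
  v@_m = c /\ forall m', (m < m')%O -> v@_m' = 0.

Definition degle v (d : nat) := forall m, (d < mdeg m)%N -> v@_m = 0.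

Lemma leadatX m : leadat 'X_[m] m 1.
Proof.
by split=> [|m' mm']; rewrite mcoeffX ?eqxx // (lt_eqF mm').
Qed.

Lemma leadatD u v m c d : leadat u m c -> leadat v m d -> leadat (u + v) m (c + d).
Proof.
move=> [<- u0] [<- v0]; split=> [|m' mm']; rewrite mcoeffD //.
by rewrite u0 // v0 // addr0.
Qed.

Lemma leadatZ k v m c : leadat v m c -> leadat (k *: v) m (k * c).
Proof.
move=> [<- v0]; split=> [|m' mm']; rewrite mcoeffZ //.
by rewrite v0 // mulr0.
Qed.

Lemma leadat_lt v m m' c : leadat v m c -> (m < m')%O -> leadat v m' 0.
Proof. by move=> [_ v0] mm'; split=> [|k /(lt_trans mm')]; apply: v0. Qed.

Lemma leadat_inj v m m' c c' : leadat v m c -> leadat v m' c' ->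
  c != 0 -> c' != 0 -> m = m' /\ c = c'.
Proof.
move=> [<- v0] [<- v0'] c0 c0'; case: (ltgtP m m') => [/v0 e|/v0' e|<-] //.
- by rewrite e eqxx in c0'.
- by rewrite e eqxx in c0.
Qed.

Lemma leadat_mlead v : leadat v (mlead v) (mleadc v).
Proof. by split=> // m; apply: mcoeff_gt_mlead. Qed.

Lemma degle_leadat v d m : degle v d -> (d < mdeg m)%N -> leadat v m 0.
Proof.
move=> vd dm; split=> [|m' /ltW /lemc_mdeg mm']; first exact: vd.
by apply: vd; apply: leq_trans mm'.
Qed.

Lemma leadat_degle v m c d : leadat v m c -> (mdeg m <= d)%N -> degle v d.
Proof. by move=> [_ v0] md m' /(leq_ltn_trans md)/lt_mdeg_ltmc/v0. Qed.

Lemma degle_mlead v d : v != 0 -> degle v d -> (mdeg (mlead v) <= d)%N.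
Proof.
move=> v0 vd; rewrite leqNgt; apply/negP => /vd /eqP.
by rewrite mleadc_eq0 (negPf v0).
Qed.

Lemma degle_lin v u d c : degle u d -> degle v d -> degle (c *: u + v) d.
Proof.
by move=> ud vd m dm; rewrite mcoeffD mcoeffZ ud // vd // mulr0 addr0.
Qed.

(** A triangularity argument: monomials of v below m contribute nothing at or above m', those above
    m are absent, so only m itself counts. *)
Lemma leadat_lext (G : 'X_{1..N} -> {mpoly K[N]}) v m c m' e :
  leadat v m c -> (forall k, (k < m)%O -> leadat (G k) m' 0) ->
  leadat (G m) m' e -> leadat (lext G v) m' (c * e).
Proof.
move=> [vm v0] G0 Gm.
have term k : leadat (v@_k *: G k) m' (if k == m then c * e else 0).
  have [->|km] := eqVneq k m; first by rewrite vm; apply: leadatZ.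
  have [lt|gt|e'] := ltgtP k m.
  - by rewrite -[0](mulr0 v@_k); apply/leadatZ/G0.
  - rewrite v0 // scale0r; split=> [|? _]; exact: mcoeff0.
  - by rewrite e' eqxx in km.
have sum s : leadat (\sum_(k <- s) v@_k *: G k) m'
                    (\sum_(k <- s) if k == m then c * e else 0).
  elim: s => [|k s IH]; first by rewrite !big_nil; split=> [|? _]; exact: mcoeff0.
  by rewrite !big_cons; apply: leadatD.
have := sum (msupp v); rewrite -/(lext G v); congr leadat.
have [ms|ms] := boolP (m \in msupp v).
  rewrite (bigD1_seq m) ?msupp_uniq //= eqxx big1 ?addr0 //.
  by move=> k /negPf ->.
rewrite big1_seq.
  by move: ms; rewrite mcoeff_msupp negbK vm => /eqP ->; rewrite mul0r.
by move=> k /= ks; case: eqVneq ks ms => // -> ->.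
Qed.

End LeadingTerms.

(** * Leading terms of products, and twists *)

Section Leads.
Variables (K : fieldType) (n : nat) (q : 'I_n -> K) (L : 'I_n -> 'I_n -> K).
Variables (A : algType K) (x y : 'I_n -> A).
Hypothesis q_neq0 : forall i, q i != 0.
Hypothesis q_root : forall i (k : nat), (0 < k)%N -> q i ^+ k != 1.
Hypothesis L_neq0 : forall i j, L i j != 0.
Hypothesis L_inv : forall i j, L i j = (L j i)^-1.
Hypothesis L_diag : forall i, L i i = 1.
Hypothesis rels : qweyl_rels q L x y.
Variable ev : A -> {mpoly K[n + n]}.
Hypothesis ev_linear : linear ev.
Hypothesis ev1 : ev 1 = 1.
Hypothesis ev_x : forall i a, ev (x i * a) = xop q L i (ev a).
Hypothesis ev_y : forall i a, ev (y i * a) = yop q L i (ev a).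
Local Notation theta := (theta x y).
Local Notation pbw := (pbw x y).
Hypothesis evK : cancel ev theta.
Implicit Types (i j : 'I_n) (m : 'X_{1..n + n}) (a b : A).

HB.instance Definition _ := GRing.isLinear.Build K _ _ _ ev ev_linear.

Lemma ev_inj : injective ev. Proof. exact: can_inj evK. Qed.

Lemma ev_neq0 a : a != 0 -> ev a != 0.
Proof. by apply: contraNneq => a0; apply/eqP/ev_inj; rewrite linear0. Qed.

Lemma leadat_ev1 : leadat (ev 1) 0%MM 1.
Proof. by rewrite ev1 -mpolyX0; apply: leadatX. Qed.

Definition lead_mult b (mu : 'X_{1..n + n}) (s : 'X_{1..n + n} -> K) :=
  forall a m d, leadat (ev a) m d -> leadat (ev (b * a)) (mu + m) (d * s m).

Definition good b mu := exists2 s, lead_mult b mu s & forall m, s m != 0.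

Lemma lead_mult_op (F : endo (mpoly1_neq0 K n)) b mu s :
  (forall a, ev (b * a) = F (ev a)) ->
  (forall m, leadat (F 'X_[m]) (mu + m)%MM (s m)) -> lead_mult b mu s.
Proof.
move=> bF Fs a m d am; rewrite bF.
have -> : F (ev a) = lext (fun m => F 'X_[m]) (ev a).
  by apply: linear_ext_mpoly => [||k]; [exact: endo_linear|exact: lext_linear|];
     rewrite lextX.
apply: leadat_lext am _ (Fs m) => k km.
by apply: leadat_lt (Fs k) _; rewrite ltmc_add2r.
Qed.

Lemma lead_mult_y i : lead_mult (y i) U_(vy i) (chi L i).
Proof.
apply: lead_mult_op (ev_y i) _ => m; rewrite yopX addmC.
by rewrite -{2}[chi L i m]mulr1; apply/leadatZ/leadatX.
Qed.

Lemma lead_mult_x i :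
  lead_mult (x i) U_(vx i) (fun m => (chi L i m)^-1 * q i ^+ m (vy i)).
Proof.
apply: lead_mult_op (ev_x i) _ => m; rewrite xopX addmC; apply: leadatZ.
rewrite -[_ ^+ _ in X in leadat _ _ X]addr0; apply: leadatD.
  by rewrite -{2}[_ ^+ _]mulr1; apply/leadatZ/leadatX.
rewrite -[0](mulr0 (qint (q i) (m (vy i)))); apply: leadatZ.
(* The order compares degrees first, so the term that loses a y_i lies below the one that gains an
   x_i. *)
apply: leadat_lt (leadatX _ _) _; apply: lt_mdeg_ltmc.
by rewrite mdegD mdeg1 ?addn1 ?add1n ltnS mdegB.
Qed.

Lemma good_y i : good (y i) U_(vy i).
Proof. by exists (chi L i); [exact: lead_mult_y|move=> m; exact: chi_neq0]. Qed.

Lemma good_x i : good (x i) U_(vx i).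
Proof.
eexists; first exact: lead_mult_x.
by move=> m; rewrite mulf_neq0 ?invr_eq0 ?chi_neq0 // expf_neq0.
Qed.

Lemma good1 : good 1 0%MM.
Proof.
exists (fun => 1) => [a m d am|m]; last exact: oner_neq0.
by rewrite mul1r add0m mulr1.
Qed.

Lemma goodM b b' mu mu' : good b mu -> good b' mu' -> good (b * b') (mu + mu')%MM.
Proof.
move=> [s bs s0] [s' bs' s0'].
exists (fun m => s' m * s (mu' + m)%MM) => [a m d am|m]; last exact: mulf_neq0.
by move: (bs _ _ _ (bs' _ _ _ am)); rewrite addmA !mulrA.
Qed.

Lemma goodX b mu k : good b mu -> good (b ^+ k) (mu *+ k)%MM.
Proof.
move=> gb; elim: k => [|k IH]; first exact: good1.
by rewrite exprS mulmS; apply: goodM.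
Qed.

Lemma mnm_blocks m :
  (\sum_(j < n) (U_(vy j) *+ m (vy j) + U_(vx j) *+ m (vx j)))%MM = m.
Proof.
rewrite big_split /= [in RHS](multinomUE_id m) big_split_ord /=.
by congr (_ + _)%MM.
Qed.

Lemma good_pbw m : good (pbw m) m.
Proof.
rewrite -[X in good _ X]mnm_blocks /pbw.
elim/big_rec2: _ => [|j b mu _ gb]; first exact: good1.
by apply: goodM gb; apply: goodM; apply: goodX; [exact: good_y|exact: good_x].
Qed.

Lemma ev_mulE b a : ev (b * a) = lext (fun m => ev (pbw m * a)) (ev b).
Proof.
rewrite -{1}[b]evK; move: (ev b).
apply: linear_ext_mpoly => [c u v||m]; last by rewrite lextX thetaX.
  by rewrite linearP mulrDl -scalerAl linearP.
exact: lext_linear.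
Qed.

(** The scalar k is fixed before the elements, so it depends on the two monomials only;
    [lead_normal] cancels it between [g * f] and [s * f]. *)
Lemma lead_mul mu nu : exists2 k : K, k != 0 &
  forall a b c d, leadat (ev b) mu c -> leadat (ev a) nu d ->
  leadat (ev (b * a)) (mu + nu)%MM (c * (d * k)).
Proof.
have [s gs s0] := good_pbw mu; exists (s nu) => // a b c d bc ad.
rewrite ev_mulE; apply: leadat_lext bc _ (gs _ _ _ ad) => m mmu.
have [s' gs' _] := good_pbw m.
by apply: leadat_lt (gs' _ _ _ ad) _; rewrite ltmc_add2l.
Qed.

Lemma qweyl_mul_neq0 a b : a != 0 -> b != 0 -> a * b != 0.
Proof.
move=> /ev_neq0 a0 /ev_neq0 b0.
have [k k0 kP] := lead_mul (mlead (ev a)) (mlead (ev b)).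
have [] := kP _ _ _ _ (leadat_mlead _) (leadat_mlead _).
move=> e _; apply/eqP => ab0; move/esym/eqP: e; apply/negP.
by rewrite ab0 linear0 mcoeff0 !mulf_neq0 // mleadc_eq0.
Qed.

Lemma degle_mul a b d e : degle (ev a) d -> degle (ev b) e -> degle (ev (a * b)) (d + e).
Proof.
have z m : (ev 0)@_m = 0 by rewrite linear0 mcoeff0.
have [->|/ev_neq0 a0] := eqVneq a 0; first by rewrite mul0r => _ _ m _.
have [->|/ev_neq0 b0] := eqVneq b 0; first by rewrite mulr0 => _ _ m _.
move=> /(degle_mlead a0) ad /(degle_mlead b0) be.
have [k _ kP] := lead_mul (mlead (ev a)) (mlead (ev b)).
apply: leadat_degle (kP _ _ _ _ (leadat_mlead _) (leadat_mlead _)) _.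
by rewrite mdegD leq_add.
Qed.

(** Generation of A by x and y as an induction principle, read off from PBW expansions. *)
Lemma pbw_ind (P : A -> Prop) : P 1 -> (forall i, P (x i)) -> (forall i, P (y i)) ->
  (forall a b, P a -> P b -> P (a + b)) -> (forall a b, P a -> P b -> P (a * b)) ->
  (forall (c : K) a, P a -> P (c *: a)) -> forall a, P a.
Proof.
move=> P1 Px Py PD PM PZ a; rewrite -[a]evK /theta /lext.
apply: (big_ind P) => [||m _]; [by rewrite -(scale0r 1); apply: PZ|by []|].
apply/PZ/(big_ind P) => // j _.
have PX b k : P b -> P (b ^+ k).
  by move=> Pb; elim: k => [|k IH]; rewrite ?expr0 // exprS; apply: PM.
by apply: PM; apply: PX.
Qed.

(* b g = c g b up to terms of degree at most deg b, instead of deg b + 1. *)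
Definition qcomm_low (g b : A) (d : nat) (c : K) :=
  degle (ev b) d /\ degle (ev (b * g - c *: (g * b))) d.

Lemma degle_ev1 d : degle (ev 1) d.
Proof. by apply: leadat_degle leadat_ev1 _; rewrite mdeg0. Qed.

Lemma qcomm_low1 g : qcomm_low g 1 0 1.
Proof.
split; first exact: degle_ev1.
by rewrite mul1r mulr1 scale1r subrr linear0 => m _; rewrite mcoeff0.
Qed.

Lemma qcomm_lowM g b b' d d' c c' : qcomm_low g b d c -> qcomm_low g b' d' c' ->
  qcomm_low g (b * b') (d + d') (c * c').
Proof.
move=> [bd bg] [bd' bg']; split; first exact: degle_mul.
(* The Leibniz rule for twisted commutators. *)
have -> : b * b' * g - (c * c') *: (g * (b * b')) =
  c' *: ((b * g - c *: (g * b)) * b') + b * (b' * g - c' *: (g * b')).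
  rewrite mulrBl mulrBr scalerBr -scalerAl -!scalerAr scalerA [c' * c]mulrC !mulrA.
  by rewrite [RHS]addrC addrA subrK.
by rewrite linearP; apply: degle_lin; apply: degle_mul.
Qed.

Lemma qcomm_lowX g b d c k : qcomm_low g b d c -> qcomm_low g (b ^+ k) (d * k) (c ^+ k).
Proof.
move=> gb; elim: k => [|k IH]; first by rewrite muln0; apply: qcomm_low1.
by rewrite !exprS mulnS; apply: qcomm_lowM.
Qed.

Lemma qcomm_low_pbw g (cy cx : 'I_n -> K) m :
  (forall j, qcomm_low g (y j) 1 (cy j)) -> (forall j, qcomm_low g (x j) 1 (cx j)) ->
  qcomm_low g (pbw m) (mdeg m) (\prod_(j < n) (cy j ^+ m (vy j) * cx j ^+ m (vx j))).
Proof.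
move=> gy gx; have -> : mdeg m = (\sum_(j < n) (1 * m (vy j) + 1 * m (vx j)))%N.
  rewrite mdegE big_split_ord big_split /=.
  by congr (_ + _)%N; apply: eq_bigr => j _; rewrite mul1n.
rewrite /pbw; elim/big_rec3: _ => [|j c d b _ gb]; first exact: qcomm_low1.
by apply: qcomm_lowM gb; apply: qcomm_lowM; apply: qcomm_lowX.
Qed.

Lemma degle_ev_y i : degle (ev (y i)) 1.
Proof.
rewrite -[y i]mulr1; apply: leadat_degle (@lead_mult_y i _ _ _ leadat_ev1) _.
by rewrite addm0 mdeg1.
Qed.

Lemma degle_ev_x i : degle (ev (x i)) 1.
Proof.
rewrite -[x i]mulr1; apply: leadat_degle (@lead_mult_x i _ _ _ leadat_ev1) _.
by rewrite addm0 mdeg1.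
Qed.

Lemma leadat_ev_y i : leadat (ev (y i)) U_(vy i) 1.
Proof. by have := @lead_mult_y i _ _ _ leadat_ev1; rewrite addm0 mulr1 chi0 mulr1. Qed.

Lemma leadat_ev_x i : leadat (ev (x i)) U_(vx i) 1.
Proof.
have := @lead_mult_x i _ _ _ leadat_ev1.
by rewrite /= addm0 mulr1 mnm0E expr0 chi0 invr1 !mulr1.
Qed.

Lemma qcomm_low_C g b d c k :
  degle (ev b) d -> b * g - c *: (g * b) = k *: 1 -> qcomm_low g b d c.
Proof.
move=> bd e; split=> // m dm; rewrite e linearZ mcoeffZ.
by rewrite (degle_ev1 dm) mulr0.
Qed.

(** Unlike [chi] this sees all blocks: up to a power of [q i] and lower terms, it is the scalar for
    moving y_i from the right of the whole monomial to its left. For x_i it is the inverse. *)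
Definition Lam i m : K := \prod_(j < n) (L j i ^+ m (vy j) * L i j ^+ m (vx j)).

Lemma Lam_neq0 i m : Lam i m != 0.
Proof. by apply/prodf_neq0 => j _; rewrite mulf_neq0 // expf_neq0. Qed.

Lemma prod_indic i (c : K) (e : 'I_n -> nat) :
  \prod_(j < n) (if j == i then c else 1) ^+ e j = c ^+ e i.
Proof.
rewrite (bigD1 i) //= eqxx big1 ?mulr1 // => j /negPf ->; exact: expr1n.
Qed.

Lemma qcomm_low_pbw_y i m :
  qcomm_low (y i) (pbw m) (mdeg m) (Lam i m * q i ^+ m (vx i)).
Proof.
have := @qcomm_low_pbw (y i) (fun j => L j i)
  (fun j => L i j * (if j == i then q i else 1)) m.
have -> : \prod_(j < n) (L j i ^+ m (vy j) *
    (L i j * (if j == i then q i else 1)) ^+ m (vx j)) = Lam i m * q i ^+ m (vx i).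
  rewrite -(prod_indic i (q i) (fun j => m (vx j))) /Lam -big_split /=.
  by apply: eq_bigr => j _; rewrite exprMn mulrA.
apply=> j.
  apply: (@qcomm_low_C _ _ _ _ 0); first exact: degle_ev_y.
  by rewrite scale0r (rel_yy L_neq0 L_inv L_diag rels) subrr.
have [->|ji] := eqVneq j i.
  apply: (@qcomm_low_C _ _ _ _ 1); first exact: degle_ev_x.
  by rewrite L_diag mul1r scale1r rels.2.
apply: (@qcomm_low_C _ _ _ _ 0); first exact: degle_ev_x.
by rewrite scale0r mulr1 (rel_xy rels) // subrr.
Qed.

Lemma qcomm_low_pbw_x i m :
  qcomm_low (x i) (pbw m) (mdeg m) ((Lam i m)^-1 * (q i)^-1 ^+ m (vy i)).
Proof.
have := @qcomm_low_pbw (x i) (fun j => L i j * (if j == i then (q i)^-1 else 1))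
  (fun j => L j i) m.
have -> : \prod_(j < n) ((L i j * (if j == i then (q i)^-1 else 1)) ^+ m (vy j) *
    L j i ^+ m (vx j)) = (Lam i m)^-1 * (q i)^-1 ^+ m (vy i).
  rewrite -(prod_indic i (q i)^-1 (fun j => m (vy j))) /Lam -prodfV -big_split /=.
  apply: eq_bigr => j _; rewrite exprMn invfM -!exprVn -!L_inv.
  by rewrite mulrAC.
apply=> j; last first.
  apply: (@qcomm_low_C _ _ _ _ 0); first exact: degle_ev_x.
  by rewrite scale0r (rel_xx L_neq0 L_inv L_diag rels) subrr.
have [->|ji] := eqVneq j i.
  (* The constant comes from y_i x_i = q_i^-1 (x_i y_i - 1). *)
  apply: (@qcomm_low_C _ _ _ _ (- (q i)^-1)); first exact: degle_ev_y.
  rewrite L_diag mul1r (rel_xyi rels) scalerDr scalerA mulVf // scale1r scaleNr.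
  by rewrite opprD addrA subrr add0r.
apply: (@qcomm_low_C _ _ _ _ 0); first exact: degle_ev_y.
by rewrite scale0r mulr1 (rel_yx L_neq0 L_inv rels) // subrr.
Qed.

(** To leading order [s * f = f * g] agrees with [kap *: (g * f)]; cancelling f shows that s leads
    like [kap *: g]. *)
Lemma lead_normal g U f s mu c kap :
  leadat (ev g) U 1 -> mdeg U = 1 -> qcomm_low g (pbw mu) (mdeg mu) kap ->
  kap != 0 -> leadat (ev f) mu c -> c != 0 -> f * g = s * f ->
  leadat (ev s) U kap.
Proof.
move=> gU dU gmu kap0 fmu c0 fg.
have [k k0 kP] := lead_mul U mu.
have gf := kP _ _ _ _ gU fmu.
(* The difference is linear in f. On [pbw mu] its degree is at most [mdeg mu], one less than that of
   [U + mu]; smaller monomials of f have other scalars than [kap], but their products with g stay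
   below [U + mu] anyway. *)
have low : leadat (ev (f * g - kap *: (g * f))) (U + mu)%MM 0.
  have -> : ev (f * g - kap *: (g * f)) =
      lext (fun m => ev (pbw m * g - kap *: (g * pbw m))) (ev f).
    rewrite -{1 2}[f]evK; move: (ev f).
    apply: linear_ext_mpoly => [d u v||m]; [|exact: lext_linear|].
      rewrite -linearP; congr ev; rewrite linearP mulrDl mulrDr -scalerAl -scalerAr.
      rewrite !scalerDr !scalerN !scalerA [kap * d]mulrC opprD.
      by rewrite addrACA.
    by rewrite lextX thetaX.
  rewrite -[0](mulr0 c); apply: leadat_lext fmu _ _ => [m mmu|]; last first.
    by apply: degle_leadat gmu.2 _; rewrite mdegD dU.
  have [sm pm _] := good_pbw m.
  have := pm _ _ _ leadat_ev1; rewrite mulr1 addm0 => pbwm.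
  have [k1 _ /(_ _ _ _ _ pbwm gU) P1] := lead_mul m U.
  have [k2 _ /(_ _ _ _ _ gU pbwm) P2] := lead_mul U m.
  rewrite linearB linearZ /= -scaleNr -[0](addr0 0) -[X in 0 + X](mulr0 (- kap)).
  apply: leadatD; last apply: leadatZ.
    by apply: leadat_lt P1 _; rewrite addmC ltmc_add2r.
  by apply: leadat_lt P2 _; rewrite ltmc_add2r.
have fgl : leadat (ev (f * g)) (U + mu)%MM (kap * (1 * (c * k))).
  have -> : ev (f * g) = ev (f * g - kap *: (g * f)) + kap *: ev (g * f).
    by rewrite linearB linearZ /= subrK.
  by rewrite -[X in leadat _ _ X]add0r; apply: leadatD low (leadatZ _ gf).
have nz : kap * (1 * (c * k)) != 0 by rewrite !mulf_neq0 ?oner_neq0.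
have s0 : ev s != 0.
  apply/ev_neq0; apply: contra_neq nz => s0; case: fgl => <- _.
  by rewrite fg s0 mul0r linear0 mcoeff0.
have [k' k0' /(_ _ _ _ _ (leadat_mlead (ev s)) fmu)] := lead_mul (mlead (ev s)) mu.
rewrite -fg => fgl'.
have nz' : mleadc (ev s) * (c * k') != 0 by rewrite !mulf_neq0 // mleadc_eq0.
have [/addIm eU _] := leadat_inj fgl fgl' nz nz'.
have sU : leadat (ev s) U (mleadc (ev s)) by rewrite eU; apply: leadat_mlead.
have := kP _ _ _ _ sU fmu; rewrite -fg => /(leadat_inj fgl) [//||_].
  by rewrite !mulf_neq0 // mleadc_eq0.
by rewrite mul1r => /mulIf -> //; rewrite mulf_neq0.
Qed.

Lemma q_exp_inj i : injective (GRing.exp (q i)).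
Proof.
have le k l : (k <= l)%N -> q i ^+ k = q i ^+ l -> k = l.
  move=> kl e; apply/eqP; rewrite eqn_leq kl leqNgt -subn_gt0.
  apply: contraL (eqxx (q i ^+ l)) => /(q_root i); apply: contraNN => _.
  by rewrite -(inj_eq (mulfI (expf_neq0 k (q_neq0 i)))) -exprD subnKC // mulr1 e.
by move=> k l e; case/orP: (leq_total k l) => h; [apply: le|apply/esym/le].
Qed.

(** Let a_i and b_i be the exponents of y_i and x_i. Multiplying the two equations removes [Lam] and
    determines b_i - a_i. [Lam] depends on these differences only, so it cancels from the first
    equation, which then gives b_i, hence a_i. *)
Lemma qcomm_scalars_inj mu nu :
  (forall i, Lam i mu * q i ^+ mu (vx i) = Lam i nu * q i ^+ nu (vx i)) ->
  (forall i, (Lam i mu)^-1 * (q i)^-1 ^+ mu (vy i) =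
             (Lam i nu)^-1 * (q i)^-1 ^+ nu (vy i)) -> mu = nu.
Proof.
move=> hy hx.
have wt i : (mu (vx i) + nu (vy i) = nu (vx i) + mu (vy i))%N.
  apply: (@q_exp_inj i); rewrite /= !exprD.
  have l0 := Lam_neq0 i mu; have l0' := Lam_neq0 i nu.
  have b0 := expf_neq0 (mu (vy i)) (q_neq0 i).
  have d0 := expf_neq0 (nu (vy i)) (q_neq0 i).
  have := congr2 *%R (hy i) (hx i); rewrite !exprVn.
  move: l0 l0' b0 d0; set l := Lam i mu; set l' := Lam i nu.
  set a := q i ^+ mu (vx i); set b := q i ^+ mu (vy i).
  set c := q i ^+ nu (vx i); set d := q i ^+ nu (vy i) => l0 l0' b0 d0 e.
  have e1 : l * a * (l^-1 / b) = a / b by field; rewrite b0 l0.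
  have e2 : l' * c * (l'^-1 / d) = c / d by field; rewrite d0 l0'.
  by apply/eqP; rewrite -eqr_div // -e1 -e2 e.
have LamE i : Lam i mu = Lam i nu.
  apply: eq_bigr => j _; rewrite [L i j]L_inv !exprVn; apply/eqP.
  rewrite eqr_div ?expf_neq0 // -!exprD [(nu _ + mu _)%N]addnC wt.
  by rewrite addnC.
have xE i : mu (vx i) = nu (vx i).
  by apply: (@q_exp_inj i); apply: (mulfI (Lam_neq0 i nu)); rewrite -hy LamE.
apply: mnm_vP => // i; have := wt i; rewrite xE.
by move/addnI.
Qed.

(* Comparing leading coefficients in f * g = s_g * f, for g a generator, shows that
   the twists s determine the leading monomial of f. *)
Lemma normal_same_lead (f f' : A) (sx sy : 'I_n -> A) : f != 0 -> f' != 0 ->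
  (forall i, f * x i = sx i * f) -> (forall i, f' * x i = sx i * f') ->
  (forall i, f * y i = sy i * f) -> (forall i, f' * y i = sy i * f') ->
  mlead (ev f) = mlead (ev f').
Proof.
move=> f0 f0' fx fx' fy fy'.
have kapy i m : Lam i m * q i ^+ m (vx i) != 0.
  by rewrite mulf_neq0 ?Lam_neq0 ?expf_neq0.
have kapx i m : (Lam i m)^-1 * (q i)^-1 ^+ m (vy i) != 0.
  by rewrite mulf_neq0 ?expf_neq0 ?invr_eq0 ?Lam_neq0.
have leadc a : a != 0 -> mleadc (ev a) != 0 by move=> /ev_neq0; rewrite mleadc_eq0.
have Y a i : a != 0 -> a * y i = sy i * a ->
    leadat (ev (sy i)) U_(vy i) (Lam i (mlead (ev a)) * q i ^+ mlead (ev a) (vx i)).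
  move=> a0; apply: lead_normal (leadat_ev_y i) (mdeg1 _) (qcomm_low_pbw_y _ _) _
    (leadat_mlead _) (leadc _ a0); exact: kapy.
have X a i : a != 0 -> a * x i = sx i * a ->
    leadat (ev (sx i)) U_(vx i)
      ((Lam i (mlead (ev a)))^-1 * (q i)^-1 ^+ mlead (ev a) (vy i)).
  move=> a0; apply: lead_normal (leadat_ev_x i) (mdeg1 _) (qcomm_low_pbw_x _ _) _
    (leadat_mlead _) (leadc _ a0); exact: kapx.
apply: qcomm_scalars_inj => i.
  by have [<- _] := Y _ _ f0 (fy i); have [<- _] := Y _ _ f0' (fy' i).
by have [<- _] := X _ _ f0 (fx i); have [<- _] := X _ _ f0' (fx' i).
Qed.

(** c is chosen so that f' - c f has no term at the leading monomial of f. This difference has the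
    same twists as f, so if nonzero it would have to lead exactly there. *)
Lemma normal_proportional (f f' : A) (sx sy : 'I_n -> A) : f != 0 ->
  (forall i, f * x i = sx i * f) -> (forall i, f' * x i = sx i * f') ->
  (forall i, f * y i = sy i * f) -> (forall i, f' * y i = sy i * f') ->
  exists c : K, f' = c *: f.
Proof.
move=> f0 fx fx' fy fy'; pose mu := mlead (ev f).
pose c := (ev f')@_mu / mleadc (ev f); exists c.
apply/eqP; rewrite -subr_eq0; apply/negPn/negP => d0.
have same g s : f * g = s * f -> f' * g = s * f' ->
    (f' - c *: f) * g = s * (f' - c *: f).
  by move=> e e'; rewrite mulrBl mulrBr e' -scalerAl e scalerAr.
have e := normal_same_lead f0 d0 fx (fun i => same _ _ (fx i) (fx' i))
                           fy (fun i => same _ _ (fy i) (fy' i)).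
have : mleadc (ev (f' - c *: f)) != 0 by rewrite mleadc_eq0 ev_neq0.
rewrite -e linearB linearZ /= mcoeffB mcoeffZ /c mulfVK ?subrr ?eqxx //.
by rewrite mleadc_eq0 ev_neq0.
Qed.

End Leads.

(** * Automorphisms of A[t] are triangular *)

Section TriangularAutomorphisms.
Variables (K : fieldType) (n : nat) (q : 'I_n -> K).
Variables (A : algType K) (x y : 'I_n -> A).
Local Notation z i := (1 + (q i - 1) *: (y i * x i)).
Hypothesis q_neq1 : forall i, q i != 1.
Hypothesis x_neq0 : forall i, x i != 0.
Hypothesis y_neq0 : forall i, y i != 0.
Hypothesis A_domain : forall a b : A, a != 0 -> b != 0 -> a * b != 0.
Hypothesis A_ind : forall P : A -> Prop,
  P 1 -> (forall i, P (x i)) -> (forall i, P (y i)) ->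
  (forall a b, P a -> P b -> P (a + b)) -> (forall a b, P a -> P b -> P (a * b)) ->
  (forall (c : K) a, P a -> P (c *: a)) -> forall a, P a.
Hypothesis normal_prop : forall (f f' : A) (sx sy : 'I_n -> A), f != 0 ->
  (forall i, f * x i = sx i * f) -> (forall i, f' * x i = sx i * f') ->
  (forall i, f * y i = sy i * f) -> (forall i, f' * y i = sy i * f') ->
  exists c : K, f' = c *: f.
Hypothesis z_normal : forall i (a : A), exists a' : A, z i * a = a' * z i.

Local Notation iota := (map_poly (in_alg A)).
Implicit Types (p r : {poly A}) (P R : {poly K}) (h : {poly A} -> {poly A}).

Lemma size_mul_domain p r : p != 0 -> r != 0 -> size (p * r) = (size p + size r).-1.
Proof. by move=> p0 r0; rewrite size_proper_mul // A_domain // lead_coef_eq0. Qed.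

Lemma poly_mul_neq0 p r : p != 0 -> r != 0 -> p * r != 0.
Proof.
move=> p0 r0; rewrite -size_poly_gt0 size_mul_domain //.
move: p0 r0; rewrite -!size_poly_gt0.
by case: (size p) (size r) => [|a] [|b] // _ _; rewrite addnS.
Qed.

Lemma size_iota P : size (iota P) = size P. Proof. exact: size_map_poly. Qed.

(** Every coefficient has the same twists as 1, hence is a multiple of 1. *)
Lemma central_scalar_poly p : (forall a, p * a%:P = a%:P * p) -> exists P, p = iota P.
Proof.
move=> pC; have pkC k a : p`_k * a = a * p`_k.
  by have := congr1 (fun r : {poly A} => r`_k) (pC a); rewrite coefMC coefCM.
have /boolp.choice[c pc] k : exists c : K, p`_k = c *: 1.
  by apply: (normal_prop (sx := x) (sy := y)) => [|i|i|i|i];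
     rewrite ?oner_neq0 ?mul1r ?mulr1 ?pkC.
exists (\poly_(k < size p) c k); apply/polyP => k.
rewrite coef_map coef_poly; case: ltnP => ks; first by rewrite pc.
by rewrite nth_default //= scale0r.
Qed.

Lemma aut_inv h : kalg_aut_poly h -> exists h',
  [/\ kalg_aut_poly h', cancel h h' & cancel h' h].
Proof.
move=> [hD hM h1 hZ [h' hK h'K]]; exists h'; split=> //; split=> [p p'|p p'||k p|].
- by apply: (can_inj hK); rewrite hD !h'K.
- by apply: (can_inj hK); rewrite hM !h'K.
- by apply: (can_inj hK); rewrite h1 !h'K.
- by apply: (can_inj hK); rewrite hZ !h'K.
- by exists h.
Qed.

Lemma aut_iota h P R : kalg_aut_poly h -> h 'X = iota P -> h (iota R) = iota (R \Po P).
Proof.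
move=> [hD hM h1 hZ _] hX.
have hC k : h (k%:A)%:P = (k%:A)%:P by have := hZ k 1; rewrite h1 !mulr1.
have h0 : h 0 = 0 by have := hC 0; rewrite scale0r.
elim/poly_ind: R => [|R c IH]; first by rewrite comp_poly0 !rmorph0 h0.
rewrite comp_poly_MXaddC !rmorphD !rmorphM /= map_polyX !map_polyC /=.
by rewrite hD hM IH hX hC.
Qed.

Lemma aut_X_scalar h : kalg_aut_poly h -> exists P, h 'X = iota P.
Proof.
move=> hA; have [h' [_ hK h'K]] := aut_inv hA; case: hA => hD hM _ _ _.
apply: central_scalar_poly => a; rewrite -[a%:P]h'K -!hM.
by rewrite -commr_polyX.
Qed.

Lemma aut_X h : kalg_aut_poly h -> exists2 P, h 'X = iota P & size P = 2.
Proof.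
move=> hA; have [h' [hA' hK h'K]] := aut_inv hA.
have [P hX] := aut_X_scalar hA; have [R hX'] := aut_X_scalar hA'.
(* Here [R \Po P] becomes ['X], and degrees multiply under composition. *)
exists P => //; have /(congr1 (fun p : {poly A} => (size p).-1)) := aut_iota R hA hX.
rewrite -hX' h'K size_polyX size_iota size_comp_poly /= => /esym/eqP.
by rewrite muln_eq1 => /andP[_ /eqP]; case: (size P) => // k /= ->.
Qed.

Lemma aut_inj0 h p : kalg_aut_poly h -> p != 0 -> h p != 0.
Proof.
move=> [hD _ _ _ /bij_inj hI]; have h0 : h 0 = 0.
  by apply: (addrI (h 0)); rewrite -hD !addr0.
by apply: contraNneq; rewrite -{1}h0 => /hI ->.
Qed.

(* h(z_i) is normal in A[t]; the twist it induces preserves A by degree reasons, so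
   all its coefficients share that twist and are proportional. Hence h(z_i) is a
   polynomial in t times an element of A, and applying the inverse of h shows that
   the polynomial is constant. *)
Lemma aut_z h i : kalg_aut_poly h -> (size (h (z i)%:P) <= 1)%N.
Proof.
move=> hA; have [h' [hA' hK h'K]] := aut_inv hA.
set f := h _; have [->|f0] := eqVneq f 0; first by rewrite size_poly0.
have fE : f = h (z i)%:P by [].
have zpoly p : exists p', (z i)%:P * p = p' * (z i)%:P.
  elim/poly_ind: p => [|p c [p' pE]]; first by exists 0; rewrite mulr0 mul0r.
  have [c' cE] := z_normal i c; exists (p' * 'X + c'%:P).
  by rewrite mulrDr mulrDl mulrA pE -!polyCM cE -!mulrA commr_polyX.
have twist a : exists s, forall k, f`_k * a = s * f`_k.
  have [->|a0] := eqVneq a 0; first by exists 0 => k; rewrite mulr0 mul0r.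
  have [p' pE] := zpoly (h' a%:P).
  have /esym hpE : f * a%:P = h p' * f.
    by rewrite -[a%:P]h'K fE; case: hA => _ hM _ _ _; rewrite -!hM pE.
  have hp0 : h p' != 0.
    apply: contraTneq (poly_mul_neq0 f0 (_ : a%:P != 0)); last by rewrite polyC_eq0.
    by rewrite -hpE => ->; rewrite mul0r eqxx.
  have := congr1 (fun p : {poly A} => size p) hpE.
  rewrite !size_mul_domain ?polyC_eq0 // size_polyC a0 addn1 /=.
  move: (f0) (hp0); rewrite -!size_poly_gt0 => sf0 shp0 szE.
  have /eqP/size_poly1P[s _ sE] : size (h p') = 1%N.
    apply/eqP; rewrite -(eqn_add2r (size f)) add1n -[X in _ == X.+1]szE.
    by rewrite prednK ?addn_gt0 ?shp0.
  by exists s => k; move: hpE; rewrite sE => /polyP/(_ k); rewrite coefMC coefCM.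
have [sx sxE] := boolp.choice (fun j => twist (x j)).
have [sy syE] := boolp.choice (fun j => twist (y j)).
have /boolp.choice[c cE] k : exists c : K, f`_k = c *: lead_coef f.
  by apply: (normal_prop (sx := sx) (sy := sy)) => [|j|j|j|j];
     rewrite ?lead_coef_eq0 ?sxE ?syE.
pose P := \poly_(k < size f) c k.
have fP : f = iota P * (lead_coef f)%:P.
  apply/polyP => k; rewrite coefMC coef_map coef_poly; case: ltnP => ks.
    by rewrite cE /= mulr_algl.
  by rewrite nth_default //= scale0r mul0r.
have [R hX' sR] := aut_X hA'.
have lf0 : (lead_coef f)%:P != 0 by rewrite polyC_eq0 lead_coef_eq0.
have P0 : iota P != 0 by apply: contraNneq f0 => e; rewrite fP e mul0r.
have : size (z i)%:P = (size (iota (P \Po R)) + size (h' (lead_coef f)%:P)).-1.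
  rewrite -(aut_iota P hA' hX') -size_mul_domain ?(aut_inj0 hA') //.
  by case: hA' => _ hM _ _ _; rewrite -hM -fP hK.
rewrite size_iota => szE.
have : (size (P \Po R) + size (h' (lead_coef f)%:P) <= 2)%N.
  have : (size (z i)%:P <= 1)%N := size_polyC_leq1 _.
  by rewrite szE; case: (_ + _)%N.
have : (0 < size (h' (lead_coef f)%:P))%N by rewrite size_poly_gt0 aut_inj0.
case: (size (h' _)) => // l _; rewrite addnS ltnS => /(leq_trans (leq_addr _ _)).
(* R has degree 1, so substituting it preserves the degree of P. *)
have := size_comp_poly P R; rewrite sR muln1 => e sPR.
rewrite fP size_mul_domain // size_polyC -polyC_eq0 lf0 addn1 size_iota /=.
by move: e sPR; case: (size P) (size (P \Po R)) => [|k] [|l'] //= <-.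
Qed.

Lemma aut_const h a : kalg_aut_poly h -> (size (h a%:P) <= 1)%N.
Proof.
move=> hA; case: (hA) => hD hM h1 hZ _.
have hZ' k b : h (k *: b)%:P = (k%:A)%:P * h b%:P.
  by rewrite -hZ -polyCM mulr_algl.
have sD p r : (size p <= 1)%N -> (size r <= 1)%N -> (size (p + r)%R <= 1)%N.
  by move=> sp sr; apply: leq_trans (size_polyD _ _) _; rewrite geq_max sp.
have sM p r : (size p <= 1)%N -> (size r <= 1)%N -> (size (p * r)%R <= 1)%N.
  move=> sp sr; apply: leq_trans (size_polyMleq _ _) _.
  by move: (leq_add sp sr); case: (_ + _)%N.
have sXY i : (size (h (y i * x i)%:P) <= 1)%N.
  have q1 : q i - 1 != 0 by rewrite subr_eq0.
  have -> : y i * x i = (q i - 1)^-1 *: (z i - 1).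
    by rewrite [z i - 1]addrC addKr scalerA mulVf // scale1r.
  have -> : h ((q i - 1)^-1 *: (z i - 1))%:P = ((q i - 1)^-1%:A)%:P * (h (z i)%:P - 1).
    rewrite hZ'; congr (_ * _); rewrite polyCD hD; congr (_ + _).
    by rewrite -[- 1]scaleN1r hZ' h1 mulr1 scaleN1r polyCN.
  by rewrite sM ?size_polyC_leq1 // sD ?aut_z // size_polyN size_poly1.
have factors p r : (size (p * r)%R <= 1)%N -> p != 0 -> r != 0 ->
    (size p <= 1)%N /\ (size r <= 1)%N.
  move=> spr p0 r0; move: spr (p0) (r0); rewrite size_mul_domain //.
  rewrite -!size_poly_gt0; case: (size p) => // k; case: (size r) => // l.
  by rewrite addSn addnS /= ltnS => + _ _; case: k l => [|k] [|l].
have gens i : (size (h (x i)%:P) <= 1)%N /\ (size (h (y i)%:P) <= 1)%N.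
  by have [] := factors _ _ (eq_ind _ (fun p : {poly A} => size p <= 1)%N (sXY i) _
    (etrans (congr1 h (polyCM _ _)) (hM _ _))) ; rewrite ?aut_inj0 ?polyC_eq0.
elim/A_ind: a => [|i|i|a b sa sb|a b sa sb|c a sa].
- by rewrite h1 size_poly1.
- by have [] := gens i.
- by have [] := gens i.
- by rewrite polyCD hD sD.
- by rewrite polyCM hM sM.
- by rewrite hZ' sM ?size_polyC_leq1.
Qed.

Lemma aut_triangular h : kalg_aut_poly h -> exists (g : A -> A) (c r : K),
  [/\ kalg_aut g, c != 0, forall a, h a%:P = (g a)%:P &
      h 'X = (c%:A)%:P * 'X + (r%:A)%:P].
Proof.
move=> hA; have [h' [hA' hK h'K]] := aut_inv hA.
pose g a := (h a%:P)`_0; pose g' a := (h' a%:P)`_0.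
have hg a : h a%:P = (g a)%:P by apply/size1_polyC/aut_const.
have hg' a : h' a%:P = (g' a)%:P by apply/size1_polyC/aut_const.
have [P hX sP] := aut_X hA.
exists g, P`_1, P`_0; split=> //.
- split; last first.
    exists g' => a; apply: (@polyC_inj A).
      by rewrite -(hg' (g a)) -(hg a) hK.
    by rewrite -(hg (g' a)) -(hg' a) h'K.
  case: hA => hD hM h1 hZ _; split=> [a b|a b||k a]; apply: (@polyC_inj A).
  + by rewrite -hg !polyCD hD !hg.
  + by rewrite -hg !polyCM hM !hg.
  + by rewrite -hg.
  + by rewrite -hg -mulr_algl polyCM hZ hg -polyCM mulr_algl.
- by have := lead_coef_eq0 P; rewrite /lead_coef sP /= => ->; rewrite -size_poly_gt0 sP.
- rewrite hX; apply/polyP => k; rewrite coef_map coefD coefCM coefX coefC /=.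
  case: k => [|[|k]]; rewrite ?mulr0 ?mulr1 ?add0r ?addr0 //=.
  by rewrite nth_default ?sP // scale0r.
Qed.

End TriangularAutomorphisms.

(** * Homomorphisms out of A[t]; triangular data give automorphisms *)

Section PolynomialHomomorphisms.
Variables (K : fieldType) (A : algType K).
Implicit Types (p : {poly A}) (f : A -> {poly A}) (u : {poly A}).

Definition poly_hom f := [/\ forall a b, f (a + b) = f a + f b,
  forall a b, f (a * b) = f a * f b, f 1 = 1 &
  forall (k : K) a, f (k *: a) = (k%:A)%:P * f a].

(** Equal to [horner_morph] once f is bundled as a ring morphism; the plain sum lets f remain an
    ordinary function. *)
Definition poly_ext f u p : {poly A} := \sum_(k < size p) f p`_k * u ^+ k.

Lemma poly_ext_hom f u : poly_hom f -> (forall p, p * u = u * p) ->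
  [/\ forall p p', poly_ext f u (p + p') = poly_ext f u p + poly_ext f u p',
      forall p p', poly_ext f u (p * p') = poly_ext f u p * poly_ext f u p',
      forall a, poly_ext f u a%:P = f a,
      poly_ext f u 'X = u &
      forall (k : K) p, poly_ext f u ((k%:A)%:P * p) = (k%:A)%:P * poly_ext f u p].
Proof.
move=> [fD fM f1 fZ] uC.
have f0 : f 0 = 0 by have := fZ 0 0; rewrite !scale0r polyC0 mul0r.
have fB : additive f.
  by move=> a b; rewrite fD -scaleN1r fZ scaleN1r polyCN mulN1r.
have fMon : monoid_morphism f by [].
pose F : {rmorphism A -> {poly A}} := HB.pack f
  (GRing.isZmodMorphism.Build _ _ f fB) (GRing.isMonoidMorphism.Build _ _ f fMon).
have cfu : commr_rmorph F u by move=> a; rewrite /GRing.comm uC.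
have E p : poly_ext f u p = horner_morph cfu p.
  by rewrite /horner_morph horner_poly.
split=> [p p'|p p'|a||k p]; rewrite !E.
- exact: rmorphD.
- exact: rmorphM.
- exact: horner_morphC.
- exact: horner_morphX.
- rewrite [LHS]rmorphM; congr (_ * _); apply: etrans (horner_morphC cfu _) _.
  by rewrite /= fZ f1 mulr1.
Qed.

Lemma poly_id_eq (H : {poly A} -> {poly A}) :
  (forall p p', H (p + p') = H p + H p') -> (forall p p', H (p * p') = H p * H p') ->
  (forall a, H a%:P = a%:P) -> H 'X = 'X -> forall p, H p = p.
Proof.
move=> HD HM HC HX; elim/poly_ind => [|p c IH]; first exact: HC 0.
by rewrite HD HM IH HX HC.
Qed.

Lemma poly_ext_aut f f' u u' : poly_hom f -> poly_hom f' ->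
  (forall p, p * u = u * p) -> (forall p, p * u' = u' * p) ->
  (forall a, poly_ext f' u' (f a) = a%:P) -> (forall a, poly_ext f u (f' a) = a%:P) ->
  poly_ext f' u' u = 'X -> poly_ext f u u' = 'X -> kalg_aut_poly (poly_ext f u).
Proof.
move=> fH fH' uC uC' K1 K2 X1 X2.
have [D M C X Z] := poly_ext_hom fH uC; have [D' M' C' X' Z'] := poly_ext_hom fH' uC'.
split=> //; first by rewrite -polyC1 C; case: fH.
exists (poly_ext f' u').
- apply: (poly_id_eq (H := fun p => poly_ext f' u' (poly_ext f u p))).
  + by move=> p p'; rewrite D D'.
  + by move=> p p'; rewrite M M'.
  + by move=> a; rewrite C.
  + by rewrite X.
- apply: (poly_id_eq (H := fun p => poly_ext f u (poly_ext f' u' p))).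
  + by move=> p p'; rewrite D' D.
  + by move=> p p'; rewrite M' M.
  + by move=> a; rewrite C'.
  + by rewrite X'.
Qed.

Lemma scalar_central (k : K) p : p * (k%:A)%:P = (k%:A)%:P * p.
Proof. by apply/polyP => l; rewrite coefMC coefCM mulr_algl mulr_algr. Qed.

Lemma affine_central (c r : K) p :
  p * ((c%:A)%:P * 'X + (r%:A)%:P) = ((c%:A)%:P * 'X + (r%:A)%:P) * p.
Proof.
rewrite mulrDr mulrDl !scalar_central mulrA scalar_central -!mulrA.
by rewrite (commr_polyX p).
Qed.

Lemma kalg_aut_inv (g : A -> A) : kalg_aut g -> exists g' : A -> A,
  [/\ kalg_aut g', cancel g g' & cancel g' g].
Proof.
move=> [[gD gM g1 gZ] [g' gK g'K]]; exists g'; split=> //; split; last by exists g.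
split=> [a b|a b||k a]; apply: (can_inj gK).
- by rewrite gD !g'K.
- by rewrite gM !g'K.
- by rewrite g1 g'K.
- by rewrite gZ !g'K.
Qed.

Lemma triangular_aut (g : A -> A) (c r : K) : kalg_aut g -> c != 0 ->
  exists h : {poly A} -> {poly A}, [/\ kalg_aut_poly h,
    forall a, h a%:P = (g a)%:P & h 'X = (c%:A)%:P * 'X + (r%:A)%:P].
Proof.
move=> gA c0; have [g' [gA' gK g'K]] := kalg_aut_inv gA.
have homC (g0 : A -> A) : kalg_aut g0 -> poly_hom (fun a => (g0 a)%:P).
  move=> [[gD gM g1 gZ] _]; split=> [a b|a b||k a].
  - by rewrite gD polyCD.
  - by rewrite gM polyCM.
  - by rewrite g1.
  - by rewrite gZ -polyCM mulr_algl.
pose u c r : {poly A} := (c%:A)%:P * 'X + (r%:A)%:P.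
have H0 (e0 s0 : K) (g0 : A -> A) (gH : kalg_aut g0) :=
  poly_ext_hom (homC g0 gH) (affine_central e0 s0).
have comp e0 s0 e1 s1 (g0 : A -> A) : kalg_aut g0 ->
    poly_ext (fun a => (g0 a)%:P) (u e0 s0) (u e1 s1) = u (e1 * e0) (e1 * s0 + s1).
  move=> gH; have [D M C X Z] := H0 e0 s0 g0 gH.
  rewrite {2}/u D Z X -[((s1%:A)%:P : {poly A})]mulr1 Z -polyC1 C.
  have -> : g0 1 = 1 by case: gH => -[].
  by rewrite mulr1 /u mulrDr mulrA -!polyCM !mulr_algl !scalerA -addrA -polyCD -scalerDl.
exists (poly_ext (fun a => (g a)%:P) (u c r)).
have [D M C X Z] := H0 c r g gA; split=> //.
(* The inverse substitution, from solving c t + r for t. *)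
have [D' M' C' X' Z'] := H0 c^-1 (- (c^-1 * r)) g' gA'.
apply: (@poly_ext_aut _ (fun a => (g' a)%:P) _ (u c^-1 (- (c^-1 * r)))).
- exact: homC.
- exact: homC.
- exact: affine_central.
- exact: affine_central.
- by move=> a; rewrite C' gK.
- by move=> a; rewrite C g'K.
- rewrite comp // mulrN mulrA mulfV // mul1r addNr /u scale1r scale0r polyC0 polyC1.
  by rewrite mul1r addr0.
- rewrite comp // mulVf // subrr /u scale1r scale0r polyC0 polyC1.
  by rewrite mul1r addr0.
Qed.

End PolynomialHomomorphisms.

(** * The exponential of a locally nilpotent derivation *)

Section ExponentialAutomorphism.
Variables (K : fieldType) (A : algType K) (d : A -> A).
Hypothesis K0 : [pchar K] =i pred0.
Hypothesis d_der : kderivation d.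
Hypothesis d_nil : locally_nilpotent d.
Implicit Types (a b : A) (s : K) (k l : nat).

Lemma natf_neq0S k : k.+1%:R != 0 :> K.
Proof. by move/pcharf0P: K0 => ->. Qed.

Lemma fact_neq0 k : k`!%:R != 0 :> K.
Proof. by rewrite -(prednK (fact_gt0 k)) natf_neq0S. Qed.

Lemma derD a b : d (a + b) = d a + d b. Proof. by case: d_der. Qed.
Lemma derZ s a : d (s *: a) = s *: d a. Proof. by case: d_der. Qed.
Lemma derM a b : d (a * b) = d a * b + a * d b. Proof. by case: d_der. Qed.
Lemma der0 : d 0 = 0. Proof. by have := derZ 0 0; rewrite !scale0r. Qed.
Lemma der1 : d 1 = 0.
Proof.
by have /eqP := derM 1 1; rewrite !mulr1 mul1r -subr_eq subrr eq_sym => /eqP.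
Qed.

(** The coefficient of t^k in exp(s t d)(a); s = 1 gives the automorphism and s = -1 its inverse. *)
Definition ddiv s k a : A := (s ^+ k / k`!%:R) *: iter k d a.

Lemma ddiv0 s a : ddiv s 0 a = a.
Proof. by rewrite /ddiv expr0 divr1 scale1r. Qed.

Lemma ddivD s k a b : ddiv s k (a + b) = ddiv s k a + ddiv s k b.
Proof.
rewrite /ddiv -scalerDr; congr (_ *: _).
by elim: k => //= k ->; rewrite derD.
Qed.

Lemma iterZ k (c : K) a : iter k d (c *: a) = c *: iter k d a.
Proof. by elim: k => //= k ->; rewrite derZ. Qed.

Lemma ddivZ s k (c : K) a : ddiv s k (c *: a) = c *: ddiv s k a.
Proof. by rewrite /ddiv iterZ !scalerA mulrC. Qed.

Lemma ddiv_one s k : ddiv s k.+1 1 = 0.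
Proof.
rewrite /ddiv iterSr der1; have -> : iter k d 0 = 0 by elim: k => //= k ->; exact: der0.
exact: scaler0.
Qed.

Lemma ddivS s k a : k.+1%:R *: ddiv s k.+1 a = s *: d (ddiv s k a).
Proof.
rewrite /ddiv derZ !scalerA; congr (_ *: _).
rewrite factS natrM exprS; have := natf_neq0S k; have := fact_neq0 k.
move: (k`!%:R) k.+1%:R => u v u0 v0; field.
by rewrite u0 v0.
Qed.

Lemma ddivM s k a b : ddiv s k (a * b) = \sum_(i < k.+1) ddiv s i a * ddiv s (k - i) b.
Proof.
elim: k => [|k IH]; first by rewrite big_ord1 !ddiv0.
(* After multiplication by k + 1, the left side is s d of the previous sum; on the right, k + 1 = i
   + (k + 1 - i) splits each term according to the factor that d hits. *)
apply: (scalerI (natf_neq0S k)); rewrite ddivS IH.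
have dsum (F : 'I_k.+1 -> A) : d (\sum_i F i) = \sum_i d (F i).
  exact: (big_morph d derD der0).
rewrite dsum scaler_sumr.
under eq_bigr => i _ do
  rewrite derM scalerDr scalerAl scalerAr -!ddivS -subSn ?leq_ord //.
rewrite big_split /= scaler_sumr.
have -> : \sum_(i < k.+2) k.+1%:R *: (ddiv s i a * ddiv s (k.+1 - i) b) =
  \sum_(i < k.+2) i%:R *: (ddiv s i a * ddiv s (k.+1 - i) b) +
  \sum_(i < k.+2) (k.+1 - i)%:R *: (ddiv s i a * ddiv s (k.+1 - i) b).
  rewrite -big_split /=; apply: eq_bigr => i _; rewrite -scalerDl -natrD subnKC //.
  exact: leq_ord.
congr (_ + _); last first.
  rewrite [RHS]big_ord_recr /= subnn scale0r addr0.
  by apply: eq_bigr => i _; rewrite scalerAr.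
rewrite [RHS]big_ord_recl scale0r add0r.
by apply: eq_bigr => i _; rewrite lift0 subSS scalerAl.
Qed.

Lemma ddiv_bound s a : exists m, forall k, (m <= k)%N -> ddiv s k a = 0.
Proof.
have [m m0] := d_nil a; exists m => k /subnK <-; rewrite /ddiv iterD m0.
have -> : iter (k - m) d 0 = 0 by elim: (k - m)%N => //= l ->; exact: der0.
exact: scaler0.
Qed.

Lemma expd_exists s : exists f : A -> {poly A}, forall a k, (f a)`_k = ddiv s k a.
Proof.
have /boolp.choice[m mP] := ddiv_bound s.
exists (fun a => \poly_(k < m a) ddiv s k a) => a k.
by rewrite coef_poly; case: ltnP => // /mP ->.
Qed.

Lemma expd_hom s (f : A -> {poly A}) : (forall a k, (f a)`_k = ddiv s k a) -> poly_hom f.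
Proof.
move=> fE; split=> [a b|a b||c a]; apply/polyP => k.
- by rewrite coefD !fE ddivD.
- by rewrite coefM !fE ddivM; apply: eq_bigr => i _; rewrite !fE.
- by rewrite fE coef1; case: k => [|k]; rewrite ?ddiv0 ?ddiv_one.
- by rewrite coefCM !fE ddivZ mulr_algl.
Qed.

Lemma coef_poly_extX (f : A -> {poly A}) p l : f 0 = 0 ->
  (poly_ext f 'X p)`_l = \sum_(k < l.+1) (f p`_k)`_(l - k).
Proof.
move=> f0; rewrite /poly_ext coef_sum.
pose F k := if (k <= l)%N then (f p`_k)`_(l - k) else 0.
rewrite (eq_bigr (fun k : 'I_(size p) => F k)); last first.
  by move=> k _; rewrite coefMXn /F ltnNge; case: leqP.
rewrite [RHS](eq_bigr (fun k : 'I_l.+1 => F k)); last first.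
  by move=> k _; rewrite /F -ltnS ltn_ord.
pose M := maxn (size p) l.+1.
have widen (N : nat) : (N <= M)%N -> (forall k, (N <= k)%N -> F k = 0) ->
    \sum_(k < N) F k = \sum_(k < M) F k.
  move=> NM F0; rewrite (big_ord_widen _ F NM) big_mkcond.
  by apply: eq_bigr => k _; case: ltnP => // /F0.
rewrite !widen ?leq_maxl ?leq_maxr // => k kl; rewrite /F.
- by rewrite leqNgt kl.
- by rewrite (nth_default _ kl) f0 coef0 if_same.
Qed.

(** The identity exp(-s t) exp(s t) = 1 by coefficients: the binomial expansion of (-s + s)^l
    divided by l!. *)
Lemma sum_inv_fact s l : \sum_(k < l.+1)
  ((- s) ^+ (l - k) / (l - k)`!%:R) * (s ^+ k / k`!%:R) = (l == 0)%:R :> K.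
Proof.
case: l => [|l]; first by rewrite big_ord1 !expr0 divr1 mulr1.
apply: (mulfI (fact_neq0 l.+1)); rewrite mulr0 mulr_sumr.
rewrite -[RHS](expr0n K l.+1) -[X in X ^+ _](addNr s) exprDn.
apply: eq_bigr => k _; have kl : (k <= l.+1)%N := leq_ord k.
rewrite -(bin_fact kl) !natrM -mulr_natl; field.
by rewrite !fact_neq0.
Qed.

Lemma expd_inv s (f f' : A -> {poly A}) : (forall a k, (f a)`_k = ddiv s k a) ->
  (forall a k, (f' a)`_k = ddiv (- s) k a) -> forall a, poly_ext f' 'X (f a) = a%:P.
Proof.
move=> fE fE' a; apply/polyP => l; rewrite coef_poly_extX; last first.
  by apply/polyP => k; have := ddivZ (- s) k 0 0; rewrite fE' coef0 !scale0r.
rewrite (eq_bigr (fun k : 'I_l.+1 =>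
  (((- s) ^+ (l - k) / (l - k)`!%:R) * (s ^+ k / k`!%:R)) *: iter l d a)).
  rewrite -scaler_suml sum_inv_fact coefC; case: l => [|l]; first exact: scale1r.
  exact: scale0r.
move=> k _; rewrite fE' fE /ddiv iterZ scalerA -iterD subnK //; exact: leq_ord.
Qed.

Lemma expd_aut : exists h : {poly A} -> {poly A},
  kalg_aut_poly h /\ forall a k, (h a%:P)`_k = ddiv 1 k a.
Proof.
have [f fE] := expd_exists 1; have [f' fE'] := expd_exists (- 1).
have fH := expd_hom fE; have fH' := expd_hom fE'.
have XC (p : {poly A}) : p * 'X = 'X * p by rewrite commr_polyX.
have [_ _ C X _] := poly_ext_hom fH XC; have [_ _ _ X' _] := poly_ext_hom fH' XC.
exists (poly_ext f 'X); split; last by move=> a k; rewrite C fE.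
apply: (poly_ext_aut fH fH') => //; first exact: expd_inv fE fE'.
by apply: expd_inv fE' _ => a k; rewrite opprK fE.
Qed.

Lemma nilpotent_derivation_eq0 :
  (forall h : {poly A} -> {poly A}, kalg_aut_poly h -> forall a, exists b, h a%:P = b%:P) ->
  forall a, d a = 0.
Proof.
move=> hC a; have [h [/hC/(_ a)[b hb] hE]] := expd_aut.
by have := hE a 1%N; rewrite hb coefC /= /ddiv expr1 divr1 scale1r /= => <-.
Qed.

End ExponentialAutomorphism.

(** * Normality of z_i *)

Section NormalElements.
Variables (K : fieldType) (n : nat) (q : 'I_n -> K) (L : 'I_n -> 'I_n -> K).
Variables (A : algType K) (x y : 'I_n -> A).
Hypothesis q_neq0 : forall i, q i != 0.
Hypothesis L_neq0 : forall i j, L i j != 0.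
Hypothesis L_inv : forall i j, L i j = (L j i)^-1.
Hypothesis L_diag : forall i, L i i = 1.
Hypothesis rels : qweyl_rels q L x y.
Local Notation z i := (1 + (q i - 1) *: (y i * x i)).

Lemma LL i j : L i j * L j i = 1.
Proof. by rewrite [L i j]L_inv mulVf. Qed.

(** The scalars met by x_i and by y_i are mutually inverse, so their product contributes none. *)
Lemma z_comm_x i j : i != j -> z i * x j = x j * z i.
Proof.
move=> ij; rewrite mulrDl mulrDr mul1r mulr1; congr (_ + _).
rewrite -scalerAl -scalerAr; congr (_ *: _).
rewrite -mulrA (rel_xx L_neq0 L_inv L_diag rels i j) -scalerAr mulrA.
by rewrite (rel_yx L_neq0 L_inv rels ij) -scalerAl scalerA LL scale1r mulrA.
Qed.

Lemma z_comm_y i j : i != j -> z i * y j = y j * z i.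
Proof.
move=> ij; rewrite mulrDl mulrDr mul1r mulr1; congr (_ + _).
rewrite -scalerAl -scalerAr; congr (_ *: _).
rewrite -mulrA (rel_xy rels ij) -scalerAr mulrA.
by rewrite (rel_yy L_neq0 L_inv L_diag rels i j) -scalerAl scalerA LL scale1r mulrA.
Qed.

(** Shared by [z_x] and [z_y]: replacing x_i y_i by q_i y_i x_i + 1 produces the right side, with v
    = x_i, u = y_i x_i x_i or v = y_i, u = y_i y_i x_i. *)
Lemma scale_shift (V : lmodType K) (c : K) (u v : V) :
  c *: (v + (c - 1) *: u) = v + (c - 1) *: (c *: u + v).
Proof.
rewrite !scalerDr !scalerA [RHS]addrCA -{2}[v]scale1r -scalerDl addrCA subrr addr0.
by rewrite addrC [c * _]mulrC.
Qed.

Lemma z_x i : z i * x i = ((q i)^-1 *: x i) * z i.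
Proof.
apply: (scalerI (q_neq0 i)); rewrite -scalerAl scalerA mulfV // scale1r.
rewrite mulrDl mulrDr mul1r mulr1 -scalerAl -scalerAr mulrA (rel_xyi rels).
by rewrite mulrDl mul1r -scalerAl scale_shift.
Qed.

Lemma z_y i : z i * y i = (q i *: y i) * z i.
Proof.
rewrite mulrDl mulrDr mul1r mulr1 -!scalerAl -scalerAr -mulrA (rel_xyi rels).
by rewrite mulrDr mulr1 -scalerAr -scale_shift scalerDr.
Qed.

Lemma x_y_neq0 i : x i != 0 /\ y i != 0.
Proof.
by split; apply/eqP => e; have := rels.2 i; rewrite e mulr0 mul0r scaler0 subr0;
   move/esym/eqP; rewrite oner_eq0.
Qed.
End NormalElements.

Theorem theorem2p5 (K : fieldType) (n : nat) (q : 'I_n -> K)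
    (L : 'I_n -> 'I_n -> K) (A : algType K) (x y : 'I_n -> A) :
  (0 < n)%N ->
  (forall i, q i != 0) ->
  (forall i (m : nat), (0 < m)%N -> q i ^+ m != 1) ->
  (forall i j, L i j != 0) ->
  (forall i j, L i j = (L j i)^-1) ->
  (forall i, L i i = 1) ->
  is_qweyl q L x y ->
  (* every K-automorphism of A[t] is triangular *)
  (forall h : {poly A} -> {poly A}, kalg_aut_poly h ->
     exists (g : A -> A) (c r : K),
       [/\ kalg_aut g, c != 0,
           (forall a, h a%:P = (g a)%:P) &
           h 'X = (c%:A)%:P * 'X + (r%:A)%:P]) /\
  (* conversely every triangular datum defines an automorphism *)
  (forall (g : A -> A) (c r : K), kalg_aut g -> c != 0 ->
     exists h : {poly A} -> {poly A},
       [/\ kalg_aut_poly h,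
           (forall a, h a%:P = (g a)%:P) &
           h 'X = (c%:A)%:P * 'X + (r%:A)%:P]) /\
  (* in characteristic 0 the only locally nilpotent K-derivation is 0 *)
  ([pchar K] =i pred0 ->
     forall d : A -> A, kderivation d -> locally_nilpotent d ->
       forall a, d a = 0).
Proof.
move=> _ q_neq0 q_root L_neq0 L_inv L_diag weyl; have rels := weyl.1.
have [ev [ev_linear ev1 ev_x ev_y evK]] := pbw_coordinates L_neq0 L_inv L_diag rels weyl.
have ind := pbw_ind evK.
have tri (h : {poly A} -> {poly A}) : kalg_aut_poly h ->
    exists (g : A -> A) (c r : K), [/\ kalg_aut g, c != 0,
      forall a, h a%:P = (g a)%:P & h 'X = (c%:A)%:P * 'X + (r%:A)%:P].
  apply: (@aut_triangular K n q A x y) => [i|i|i|||f f' sx sy|i a].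
  - by have := q_root i 1%N isT; rewrite expr1.
  - by have [] := x_y_neq0 rels i.
  - by have [] := x_y_neq0 rels i.
  - exact: (qweyl_mul_neq0 q_neq0 L_neq0 ev_linear ev_x ev_y evK).
  - exact: ind.
  - exact: (normal_proportional q_neq0 q_root L_neq0 L_inv L_diag rels ev_linear ev1
      ev_x ev_y evK).
  (* Elements that can be moved across z_i form a subalgebra, so the generators suffice. *)
  elim/ind: a => [|j|j|a b [a' aE] [b' bE]|a b [a' aE] [b' bE]|c a [a' aE]].
  - by exists 1; rewrite mulr1 mul1r.
  - have [<-|ij] := eqVneq i j; first by exists ((q i)^-1 *: x i); apply: (z_x q_neq0 rels).
    by exists (x j); apply: (z_comm_x L_neq0 L_inv L_diag rels).
  - have [<-|ij] := eqVneq i j; first by exists (q i *: y i); apply: (z_y rels).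
    by exists (y j); apply: (z_comm_y L_neq0 L_inv L_diag rels).
  - by exists (a' + b'); rewrite [LHS]mulrDr aE bE -mulrDl.
  - by exists (a' * b'); rewrite [LHS]mulrA aE -[LHS]mulrA bE [LHS]mulrA.
  - by exists (c *: a'); rewrite -[LHS]scalerAr aE [LHS]scalerAl.
split=> //; split=> [g c r|K0 d d_der d_nil]; first exact: triangular_aut.
apply: nilpotent_derivation_eq0 => // h /tri[g [c [r [_ _ hg _]]]] a.
by exists (g a).
Qed.
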